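(* Let $\mathcal{C} \subseteq \mathbb{R}^d$ be a full-dimensional pointed rational polyhedral cone, and let $P \subseteq \mathbb{R}^d$ be a $\mathcal{C}$-compatible polytope. Then for fixed $n \in \mathbb{N}$, the number of $\mathcal{C}$-semigroups $S$ with exactly $n+1$ elements in the polytope $\alpha P$ (counting $0$) and with all gaps contained in $\alpha P$ is, as a function of the positive integer $\alpha$, a quasi-polynomial function of $\alpha$ of degree $nd$.
   Context: $\mathbb{N} = \{0,1,2,\ldots\}$. A rational polyhedral cone in $\mathbb{R}^d$ is the set of nonnegative real linear combinations of finitely many integer vectors; it is pointed if the only element whose additive inverse also lies in the cone is $0$; it is full-dimensional if it spans $\mathbb{R}^d$. A $\mathcal{C}$-semigroup is a subset $S \subseteq \mathcal{C} \cap \mathbb{Z}^d$ that contains $0$, is closed under addition, and has finite complement in $\mathcal{C} \cap \mathbb{Z}^d$. The points of $(\mathcal{C}\cap\mathbb{Z}^d)\setminus S$ are the gaps of $S$. A rational polytope $P \subseteq \mathbb{R}^d$ (convex hull of finitely many rational points) that contains a neighborhood of the origin in $\mathcal{C}$ is $\mathcal{C}$-compatible if for every $x \in \mathcal{C} \setminus P$, the translated cone $x + \mathcal{C}$ is a subset of $\mathcal{C} \setminus P$. The dilate is $\alpha P = \{\alpha x : x \in P\}$. A function $q$ is a quasi-polynomial if there is a positive integer modulus $K$ such that the restriction of $q$ to each congruence class modulo $K$ is given by a polynomial; its degree is the largest degree appearing among its associated polynomials. A function defined on positive integers is called quasi-polynomial if it agrees with a quasi-polynomial at all positive integers. *)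

(* Defs.v *)
From HB Require Import structures.
From mathcomp Require Import all_boot all_order all_algebra.
From mathcomp Require Import all_classical all_reals all_analysis.

Set Implicit Arguments.
Unset Strict Implicit.
Unset Printing Implicit Defensive.

Import Order.TTheory GRing.Theory Num.Theory.
Import numFieldNormedType.Exports.

Local Open Scope classical_set_scope.
Local Open Scope ring_scope.

Section Polyhedra.
Variables (R : realType) (d : nat).
Implicit Types (C P S : set 'rV[R]_d).

Definition lattice : set 'rV[R]_d :=
  range (fun z : 'rV[int]_d => map_mx intr z : 'rV[R]_d).

Definition conical_hull (m : nat) (v : 'I_m -> 'rV[R]_d) : set 'rV[R]_d :=
  [set x | exists c : 'I_m -> R,
     (forall i, 0 <= c i) /\ x = \sum_i c i *: v i].

Definition convex_hull (m : nat) (v : 'I_m -> 'rV[R]_d) : set 'rV[R]_d :=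
  [set x | exists c : 'I_m -> R,
     [/\ forall i, 0 <= c i, \sum_i c i = 1 & x = \sum_i c i *: v i]].

Definition rational_cone C :=
  exists (m : nat) (v : 'I_m -> 'rV[int]_d),
    C = conical_hull (fun i => map_mx intr (v i)).

Definition rational_polytope P :=
  exists (m : nat) (v : 'I_m -> 'rV[rat]_d),
    P = convex_hull (fun i => map_mx ratr (v i)).

Definition pointed_cone C := forall x, C x -> C (- x) -> x = 0.

(* The linear span of C is the union of the spans of its finite subfamilies. *)
Definition full_dimensional C :=
  forall x, exists X : seq 'rV[R]_d,
    (forall y, y \in X -> C y) /\ x \in <<X>>%VS.

(* P need not be contained in C: only the trace of a neighborhood of 0 on C
   is required to lie in P. *)
Definition compatible C P :=
  [/\ rational_polytope P,
      within C (nbhs (0 : 'rV[R]_d)) P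
    & forall x, (C `\` P) x -> [set x + y | y in C] `<=` C `\` P].

Definition dilate (a : R) P : set 'rV[R]_d := [set a *: x | x in P].

Definition gaps C S := (C `&` lattice) `\` S.

Definition C_semigroup C S :=
  [/\ S `<=` C `&` lattice,
      S 0,
      forall x y, S x -> S y -> S (x + y)
    & finite_set (gaps C S)].

End Polyhedra.

Section QuasiPolynomials.
Variable R : realType.

(* The constituents p r, one for each residue r modulo K, are determined by K
   and q, and the largest of their degrees does not depend on K. As
   [size] is 0 at the zero polynomial and otherwise the degree plus one, the
   last equation asserts that the largest degree is exactly D and that q is
   not identically zero, whatever D. *)
Definition quasi_polynomial_of_degree (D : nat) (q : int -> R) :=
  exists (K : nat) (p : 'I_K -> {poly R}),
    [/\ (0 < K)%N,
        forall (r : 'I_K) (a : int),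
          (a = r%:Z %[mod K%:Z])%Z -> q a = (p r).[a%:~R]
      & (\max_(r < K) size (p r) = D.+1)%N].

Definition quasi_polynomial_on_positives_of_degree (D : nat) (f : nat -> nat) :=
  exists q : int -> R,
    quasi_polynomial_of_degree D q /\
    forall a : nat, (0 < a)%N -> (f a)%:R = q a%:Z.

End QuasiPolynomials.

(* Main.v *)
Require Import Defs.
From HB Require Import structures.
From mathcomp Require Import all_boot all_order all_algebra.
From mathcomp Require Import all_classical all_reals all_analysis.
From mathcomp Require Import zify ring lra.

(** Write S for a semigroup of the family and aP for the dilate. Since the gaps
    of S lie in aP, S is determined by its nonzero points in aP: it consists
    of 0, of a set A of n nonzero lattice points of C lying in aP, and of all
    lattice points of C outside aP. By compatibility the last part absorbs
    addition of elements of C, so S is closed under addition exactly when every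
    sum of two points of A is outside aP or in A. The number of these sets A is
    the number of n by d integer matrices that list them, divided by n!
    ([card_dilate_semigroups], [card_good_sets_listings]).

    By Weyl's theorem, proved by Fourier-Motzkin elimination ([weyl]), the cone
    C and the cone over P are cut out by finitely many homogeneous linear
    inequalities with integer coefficients. A matrix M is therefore counted for
    a exactly when (M, a) satisfies a Boolean combination of inequalities
    u (M, a) <= 0 with u additive.

    Quasi-polynomiality follows by summing over one matrix entry at a time. The
    class [pw_quasipoly] of functions on an additive group, generated as an
    algebra by constants, additive forms, congruence conditions and homogeneous
    inequalities, is stable under summing the last coordinate x over
    [-w, w], with w an additive form ([pw_sum_interval]): as a function of x, an
    element of the class is a combination of univariate quasi-polynomials cut
    off at homogeneous bounds, and their sums are differences of
    antidifferences evaluated at the bounds. All inequalities stay homogeneous,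
    so that on positive integers, when the parameter a is the only variable
    left, they are constant: the resulting quasi-polynomial is valid for every
    a > 0, and not only for large a ([pw_quasipoly_pos]).

    The degree is read off from the growth of the count ([quasipoly_degree]).
    It is O(a^(nd)) because P is bounded. It is at least a multiple of a^(nd)
    along an arithmetic progression: near a point of P whose double is far
    outside P there is a cube of points of P all of whose sums leave P, and
    every n-tuple of distinct lattice points in its dilates is counted
    ([sum_free_cube], [count_ge]). *)
Set Implicit Arguments.
Unset Strict Implicit.
Unset Printing Implicit Defensive.

Import Order.TTheory GRing.Theory Num.Theory.
Import numFieldNormedType.Exports.

Local Open Scope ring_scope.

(** * Quasi-polynomials in one integer variable *)

Lemma int_residue (K : nat) (x : int) : (0 < K)%N ->
  exists (r : 'I_K) (y : int), x = y * K%:Z + r%:Z.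
Proof.
move=> K_gt0; have r_lt : (`|(x %% K%:Z)%Z| < K)%N.
  have := ltz_mod x (d := K%:Z); have := modz_ge0 x (d := K%:Z); lia.
exists (Ordinal r_lt), (x %/ K%:Z)%Z => /=.
by rewrite gez0_abs ?modz_ge0 -?divz_eq //; lia.
Qed.

Lemma dvdz_sub_residue (K : nat) (r s : 'I_K) (y : int) :
  (K %| y * K%:Z + r%:Z - s%:Z)%Z = (s == r).
Proof.
rewrite -addrA rpredDl ?dvdz_mull // -eqz_mod_dvd.
by rewrite !modz_small ?ltz_nat ?ltn_ord // eq_sym.
Qed.

Section QuasiPolynomial.
Variable R : realType.
Implicit Types (h : int -> R) (p q : {poly R}).

(** Letting r range over all integers, instead of over the residues, spares the
    reduction modulo K in the closure properties. *)
Definition quasipoly h :=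
  exists2 K : nat, (0 < K)%N &
    forall r : int, exists p, forall x : int, h (r + K%:Z * x) = p.[x%:~R].

(** A modulus may be replaced by its multiples; two functions thus get a common
    one. *)
Lemma quasipoly_multiple h : quasipoly h ->
  exists2 K : nat, (0 < K)%N &
    forall m : nat, forall r : int, exists p,
      forall x : int, h (r + (K * m)%N%:Z * x) = p.[x%:~R].
Proof.
case=> K K_gt0 hK; exists K => // m r; have [p pE] := hK r.
exists (p \Po (m%:R *: 'X)) => x.
by rewrite PoszM -mulrA pE horner_comp !hornerE rmorphM.
Qed.

Lemma quasipolyC (c : R) : quasipoly (fun=> c).
Proof. by exists 1%N => // r; exists c%:P => x; rewrite hornerC. Qed.

Lemma mul1z (x : int) : 1%N%:Z * x = x. Proof. exact: mul1r. Qed.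

Lemma quasipoly_id : quasipoly (fun x => x%:~R).
Proof.
exists 1%N => // r; exists (r%:~R%:P + 'X) => x.
by rewrite !hornerE -rmorphD; congr _%:~R; lia.
Qed.

Lemma quasipolyD h1 h2 :
  quasipoly h1 -> quasipoly h2 -> quasipoly (fun x => h1 x + h2 x).
Proof.
move=> /quasipoly_multiple[K K_gt0 hK] /quasipoly_multiple[L L_gt0 hL].
exists (K * L)%N => [|r]; first by rewrite muln_gt0 K_gt0.
have [p pE] := hK L r; have [q qE] := hL K r.
by exists (p + q) => x; rewrite pE mulnC qE hornerD.
Qed.

Lemma quasipolyM h1 h2 :
  quasipoly h1 -> quasipoly h2 -> quasipoly (fun x => h1 x * h2 x).
Proof.
move=> /quasipoly_multiple[K K_gt0 hK] /quasipoly_multiple[L L_gt0 hL].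
exists (K * L)%N => [|r]; first by rewrite muln_gt0 K_gt0.
have [p pE] := hK L r; have [q qE] := hL K r.
by exists (p * q) => x; rewrite pE mulnC qE hornerM.
Qed.

Lemma quasipoly_sum (I : Type) (s : seq I) (F : I -> int -> R) :
  (forall i, quasipoly (F i)) -> quasipoly (fun x => \sum_(i <- s) F i x).
Proof.
move=> qF; elim: s => [|i s IHs].
  by under eq_fun do rewrite big_nil; apply: quasipolyC.
by under eq_fun do rewrite big_cons; apply: quasipolyD.
Qed.

Lemma quasipoly_affine h (a b : int) :
  quasipoly h -> quasipoly (fun x => h (a * x + b)).
Proof.
case=> K K_gt0 hK; exists K => // r; have [p pE] := hK (a * r + b).
exists (p \Po (a%:~R *: 'X)) => x.
rewrite horner_comp !hornerE -rmorphM /= -pE; congr h; ring.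
Qed.

Lemma quasipoly_dvd (K : nat) (a b : int) : (0 < K)%N ->
  quasipoly (fun x => (K %| a * x + b)%Z%:R).
Proof.
move=> K_gt0; exists K => // r.
exists ((K %| a * r + b)%Z%:R)%:P => x; rewrite hornerC.
have -> : a * (r + K%:Z * x) + b = (a * r + b) + K%:Z * (a * x) by ring.
by rewrite rpredDr // dvdz_mulr.
Qed.

Lemma quasipoly_floor h (D : nat) (b : int) : (0 < D)%N ->
  quasipoly h -> quasipoly (fun x => h ((x + b) %/ D%:Z)%Z).
Proof.
move=> D_gt0 [K K_gt0 hK]; exists (K * D)%N => [|r].
  by rewrite muln_gt0 K_gt0.
have [p pE] := hK ((r + b) %/ D%:Z)%Z; exists p => x; rewrite -pE.
have -> : r + (K * D)%N%:Z * x + b = (K%:Z * x) * D%:Z + (r + b).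
  rewrite PoszM; ring.
by rewrite divzMDl 1?[in RHS]addrC //; lia.
Qed.

Lemma coefX1n n j : (('X + 1 : {poly R}) ^+ n)`_j = 'C(n, j)%:R.
Proof.
rewrite exprD1n (eq_bigr (fun i : 'I_n.+1 => 'C(n, i)%:R *: 'X^i)); last first.
  by move=> i _; rewrite scaler_nat.
rewrite -(poly_def _ (fun i => 'C(n, i)%:R)) coef_poly ltnS.
by case: leqP => // /bin_small ->.
Qed.

(** Induction on the degree k: the difference of
    (lead_coef p / (k + 1)) X^(k+1) has the leading term of p. *)
Lemma poly_antidifference p :
  exists q : {poly R}, forall x : R, q.[x + 1] - q.[x] = p.[x].
Proof.
have [s] := ubnP (size p); elim: s p => // s IHs p; rewrite ltnS => ps.
have [->|p_neq0] := eqVneq p 0.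
  by exists 0 => x; rewrite !horner0 subrr.
set k := (size p).-1; have sz_p : size p = k.+1.
  by rewrite /k prednK // size_poly_gt0.
set q0 : {poly R} := (lead_coef p / k.+1%:R) *: 'X^(k.+1).
set e : {poly R} := (q0 \Po ('X + 1)) - q0.
have e_size : (size (p - e)%R <= k)%N.
  apply/leq_sizeP => j; rewrite leq_eqVlt => /predU1P[<-|kj].
    rewrite coefB /e /q0 linearZ /= comp_Xn_poly coefB !coefZ coefX1n coefXn.
    rewrite binSn (ltn_eqF (ltnSn k)) mulr0 subr0 mulfVK ?pnatr_eq0 //.
    by rewrite lead_coefE subrr.
  rewrite coefB /e /q0 linearZ /= comp_Xn_poly coefB !coefZ coefX1n coefXn.
  rewrite nth_default ?sz_p // -mulrBr.
  case: (ltngtP j k.+1) kj => // [kj _|-> _].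
    by rewrite bin_small // subrr mulr0 subrr.
  by rewrite binn subrr mulr0 subrr.
have [|q qE] := IHs (p - e).
  by rewrite sz_p in ps; apply: leq_ltn_trans e_size _.
exists (q + q0) => x.
have eE : e.[x] = q0.[x + 1] - q0.[x] by rewrite !hornerE horner_comp !hornerE.
have := qE x; rewrite [(p - e).[x]]hornerD hornerN eE !hornerD => /eqP.
by rewrite subr_eq => /eqP ->; ring.
Qed.

(** On the progression of residue r, h is the difference of a polynomial
    [q r]. Evaluating [q r] at the number of terms of that progression before x
    gives a function that jumps by the value of h when x has residue r, and is
    constant otherwise; [H] is the sum of these functions over all residues. *)
Lemma quasipoly_antidifference h : quasipoly h ->
  exists2 H, quasipoly H & forall x, H (x + 1) - H x = h x.
Proof.
case=> K K_gt0 hK.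
have /choice[q qE] : forall r : 'I_K, exists q : {poly R}, forall x : int,
    q.[x%:~R + 1] - q.[x%:~R] = h (r%:Z + K%:Z * x).
  move=> r; have [p pE] := hK r%:Z; have [q qE] := poly_antidifference p.
  by exists q => x; rewrite pE qE.
pose F (r : 'I_K) x := (q r).[((x - 1 - r%:Z) %/ K%:Z)%Z%:~R + 1].
exists (fun x => \sum_(r <- index_enum 'I_K) F r x).
  apply: quasipoly_sum => r; rewrite /F.
  pose g y := (q r).[y%:~R + 1].
  have qg : quasipoly g.
    exists 1%N => // s; exists (q r \Po ((s%:~R + 1)%:P + 'X)) => x.
    rewrite /g mul1z horner_comp [(_ + 'X).[_]]hornerD hornerC hornerX.
    by rewrite rmorphD /=; congr _.[_]; ring.
  have := quasipoly_floor (- 1 - r%:Z) K_gt0 qg; rewrite /g.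
  by under [fun x => (q r).[_]]eq_fun do rewrite addrA.
move=> x; rewrite -sumrB.
have [r0 [y xE]] := int_residue x K_gt0.
have r0_lt := ltn_ord r0.
rewrite (bigD1 r0) //= big1 => [|r r_neq].
  rewrite addr0 /F addrK xE addrK mulzK; last by lia.
  have -> : y * K%:Z + r0%:Z - 1 - r0%:Z = (y - 1) * K%:Z + (K%:Z - 1) by ring.
  rewrite divzMDl ?[((_ - 1) %/ _)%Z]divz_small; [|lia|lia].
  have -> : (y - 1 + 0)%:~R + 1 = y%:~R :> R by rewrite addr0 rmorphB /= subrK.
  by rewrite qE; congr h; ring.
rewrite /F addrK; apply/eqP; rewrite subr_eq0; apply/eqP; congr (_.[_%:~R + 1]).
have : ~~ (K%:Z %| x - r%:Z)%Z by rewrite xE dvdz_sub_residue.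
have [s [z {}xE]] := int_residue (x - r%:Z) K_gt0.
have s_lt := ltn_ord s.
have -> : x - 1 - r%:Z = z * K%:Z + (s%:Z - 1) by lia.
rewrite xE => s_neq0.
have {}s_neq0 : s%:Z != 0.
  by apply: contra s_neq0 => /eqP ->; rewrite addr0 dvdz_mull.
rewrite !divzMDl ?[((s%:Z - 1) %/ _)%Z]divz_small;
  by rewrite ?[(s%:Z %/ _)%Z]divz_small //; lia.
Qed.

End QuasiPolynomial.

(** * Piecewise quasi-polynomials on an additive group *)

Local Notation "'1[ b ]" := ((b%R : bool)%:R) (at level 0, b at level 200).

Section Piecewise.
Variable R : realType.

Section Algebra.
Variable G : zmodType.
Implicit Types (f : G -> R) (u : G -> int).

Definition additive_form u := {morph u : x y / x + y}.

(** The inequalities are homogeneous: a bound [u g <= c] with c <> 0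
    would make the answer depend on how large the parameter is. *)
Inductive pw_quasipoly : (G -> R) -> Prop :=
| pw_cst c : pw_quasipoly (fun=> c)
| pw_form u : additive_form u -> pw_quasipoly (fun g => (u g)%:~R)
| pw_dvd u (K : nat) r : additive_form u -> (0 < K)%N ->
    pw_quasipoly (fun g => (K %| u g - r)%Z%:R)
| pw_le0 u : additive_form u -> pw_quasipoly (fun g => '1[u g <= 0])
| pw_add f1 f2 : pw_quasipoly f1 -> pw_quasipoly f2 ->
    pw_quasipoly (fun g => f1 g + f2 g)
| pw_mul f1 f2 : pw_quasipoly f1 -> pw_quasipoly f2 ->
    pw_quasipoly (fun g => f1 g * f2 g).

Lemma additive_form0 u : additive_form u -> u 0 = 0.
Proof. by move=> uD; have := uD 0 0; rewrite addr0; lia. Qed.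

Lemma additive_formN u : additive_form u -> forall g, u (- g) = - u g.
Proof.
by move=> uD g; have := uD g (- g); rewrite subrr additive_form0 //; lia.
Qed.

Lemma additive_formM u (c : int) :
  additive_form u -> additive_form (fun g => c * u g).
Proof. by move=> uD x y; rewrite uD mulrDr. Qed.

Lemma additive_formB u1 u2 : additive_form u1 -> additive_form u2 ->
  additive_form (fun g => u1 g - u2 g).
Proof. by move=> u1D u2D x y; rewrite u1D u2D; lia. Qed.

Lemma pw_sub f1 f2 : pw_quasipoly f1 -> pw_quasipoly f2 ->
  pw_quasipoly (fun g => f1 g - f2 g).
Proof.
move=> pf1 pf2; under eq_fun do rewrite -mulN1r.
exact: pw_add pf1 (pw_mul (pw_cst _) pf2).
Qed.

Lemma pw_sum (I : Type) (s : seq I) (F : I -> G -> R) :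
  (forall i, pw_quasipoly (F i)) -> pw_quasipoly (fun g => \sum_(i <- s) F i g).
Proof.
move=> pF; elim: s => [|i s IHs].
  by under eq_fun do rewrite big_nil; apply: pw_cst.
by under eq_fun do rewrite big_cons; apply: pw_add.
Qed.

Lemma pw_horner (p : {poly R}) f :
  pw_quasipoly f -> pw_quasipoly (fun g => p.[f g]).
Proof.
move=> pf; elim/poly_ind: p => [|p c IHp].
  by under eq_fun do rewrite horner0; apply: pw_cst.
under eq_fun do rewrite !hornerE.
exact: pw_add (pw_mul IHp pf) (pw_cst _).
Qed.

(** h is the sum over the residues r of its polynomial on r + K x, multiplied
    by the congruence condition that selects r. *)
Lemma quasipoly_form (h : int -> R) u :
  quasipoly h -> additive_form u -> pw_quasipoly (fun g => h (u g)).
Proof.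
case=> K K_gt0 hK uD.
have /choice[p pE] : forall r : 'I_K, exists p : {poly R},
  forall x : int, h (r%:Z + K%:Z * x) = p.[x%:~R] by move=> r; apply: hK.
pose F (r : 'I_K) g : R :=
  (K %| u g - r%:Z)%Z%:R * (p r).[((u g)%:~R - r%:R) * K%:R^-1].
have -> : (fun g => h (u g)) = (fun g => \sum_(r <- index_enum 'I_K) F r g).
  apply/funext => g.
  have [r [y uE]] := int_residue (u g) K_gt0.
  rewrite (bigD1 r) //= big1 => [|i i_neq].
    rewrite addr0 /F uE dvdz_sub_residue eqxx mul1r.
    rewrite rmorphD /= -[r%:Z%:~R]pmulrn addrK rmorphM /= -pmulrn.
    by rewrite mulfK ?pnatr_eq0 -?lt0n // -pE addrC mulrC.
  by rewrite /F uE dvdz_sub_residue (negPf i_neq) mul0r.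
apply: pw_sum => r; apply: pw_mul; first exact: pw_dvd.
apply: pw_horner; apply: pw_mul; last exact: pw_cst.
by apply: pw_sub; [apply: pw_form | apply: pw_cst].
Qed.

Lemma pw_lt0 u : additive_form u -> pw_quasipoly (fun g => '1[u g < 0]).
Proof.
move=> uD.
have -> : (fun g => '1[u g < 0] : R) = (fun g => 1 - '1[-1 * u g <= 0]).
  apply/funext => g; rewrite mulN1r oppr_le0 ltNge.
  by case: leP; rewrite ?subr0 ?subrr.
by apply: pw_sub; [apply: pw_cst | apply: pw_le0; apply: additive_formM].
Qed.

Lemma pw_lteif u1 u2 b : additive_form u1 -> additive_form u2 ->
  pw_quasipoly (fun g => '1[u1 g < u2 g ?<= if b]).
Proof.
move=> u1D u2D; case: b => /=.
  under eq_fun do rewrite -subr_le0.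
  by apply: pw_le0; apply: additive_formB.
under eq_fun do rewrite -subr_lt0.
by apply: pw_lt0; apply: additive_formB.
Qed.

End Algebra.

Lemma pw_comp (G G' : zmodType) (phi : G' -> G) f :
  {morph phi : x y / x + y} -> pw_quasipoly f ->
  pw_quasipoly (fun g => f (phi g)).
Proof.
move=> phiD; have compD u : additive_form u -> additive_form (u \o phi).
  by move=> uD x y; rewrite /= phiD uD.
elim=> {f} [c|u uD|u K r uD K_gt0|u uD|f1 f2 _ IH1 _ IH2|f1 f2 _ IH1 _ IH2].
- exact: pw_cst.
- exact: pw_form (compD u uD).
- exact: pw_dvd (compD u uD) K_gt0.
- exact: pw_le0 (compD u uD).
- exact: pw_add.
- exact: pw_mul.
Qed.

Section Summation.
Variable G : zmodType.
Implicit Types (f c : G -> R) (u : G -> int) (h : int -> R).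

(** The dependence of a normal form on the last coordinate, apart from a
    quasi-polynomial factor: no condition, or an upper bound. *)
Inductive step : (G * int -> R) -> Prop :=
| step1 : step (fun=> 1)
| step_lteif (D : nat) u b : (0 < D)%N -> additive_form u ->
    step (fun z => '1[D%:Z * z.2 < u z.1 ?<= if b]).

(** The normal form that separates the last coordinate from the others. *)
Inductive step_sum : (G * int -> R) -> Prop :=
| step_sum0 : step_sum (fun=> 0)
| step_sum_add c h s F : pw_quasipoly c -> quasipoly h -> step s ->
    step_sum F -> step_sum (fun z => c z.1 * h z.2 * s z + F z).

Lemma step_sumD F1 F2 :
  step_sum F1 -> step_sum F2 -> step_sum (fun z => F1 z + F2 z).
Proof.
move=> sF1 sF2; elim: sF1 => [|c h s F pc qh ss _ IH].
  by under eq_fun do rewrite add0r.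
by under eq_fun do rewrite -addrA; apply: step_sum_add.
Qed.

Lemma step_sum_atom c h s : pw_quasipoly c -> quasipoly h -> step s ->
  step_sum (fun z => c z.1 * h z.2 * s z).
Proof.
move=> pc qh ss; under eq_fun do rewrite -[_ * s _]addr0.
exact: step_sum_add step_sum0.
Qed.

Lemma step_sum_bigop (I : Type) (r : seq I) (F : I -> G * int -> R) :
  (forall i, step_sum (F i)) -> step_sum (fun z => \sum_(i <- r) F i z).
Proof.
move=> sF; elim: r => [|i r IHr].
  by under eq_fun do rewrite big_nil; apply: step_sum0.
by under eq_fun do rewrite big_cons; apply: step_sumD.
Qed.

(** The product of two upper bounds is the stronger one, and comparing the
    bounds is a homogeneous condition k on the other coordinates. At equality
    the strict bound is the stronger one, whence the choice of
    comparison in k. *)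
Lemma step_mul s1 s2 : step s1 -> step s2 ->
  exists2 k, pw_quasipoly k &
    forall z, s1 z * s2 z = k z.1 * s1 z + (1 - k z.1) * s2 z.
Proof.
case=> [|D u b D_gt0 uD].
  exists (fun=> 0) => [|z]; first exact: pw_cst.
  by rewrite mul0r add0r subr0 !mul1r.
case=> [|D' u' b' D'_gt0 u'D].
  exists (fun=> 1) => [|z]; first exact: pw_cst.
  by rewrite subrr mul0r addr0 mulr1 mul1r.
exists (fun g => '1[D'%:Z * u g < D%:Z * u' g ?<= if ~~ b]).
  by apply: pw_lteif; apply: additive_formM.
case=> g x /=.
suff H : (D%:Z * x < u g ?<= if b) && (D'%:Z * x < u' g ?<= if b') =
    (if D'%:Z * u g < D%:Z * u' g ?<= if ~~ b
     then D%:Z * x < u g ?<= if b else D'%:Z * x < u' g ?<= if b').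
  rewrite -natrM mulnb H; case: ifP => _.
    by rewrite subrr mul0r addr0 mul1r.
  by rewrite subr0 mul0r add0r mul1r.
have -> : (D%:Z * x < u g ?<= if b) = (D'%:Z * D%:Z * x < D'%:Z * u g ?<= if b).
  by rewrite -mulrA; case: b => /=; rewrite ?lter_pM2l.
have -> : (D'%:Z * x < u' g ?<= if b') =
    (D'%:Z * D%:Z * x < D%:Z * u' g ?<= if b').
  by rewrite -mulrA mulrCA; case: b' => /=; rewrite ?lter_pM2l.
move: (D'%:Z * D%:Z * x) (D'%:Z * u g) (D%:Z * u' g) => y v v'.
by case: (b); case: (b') => /=; case: ifP; lia.
Qed.

Lemma step_sumM F1 F2 :
  step_sum F1 -> step_sum F2 -> step_sum (fun z => F1 z * F2 z).
Proof.
move=> sF1 sF2; elim: sF1 => [|c h s F pc qh ss _ IH].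
  by under eq_fun do rewrite mul0r; apply: step_sum0.
under eq_fun do rewrite mulrDl; apply: step_sumD => //.
elim: sF2 => [|c' h' s' F' pc' qh' ss' _ IH'].
  by under eq_fun do rewrite mulr0; apply: step_sum0.
under eq_fun do rewrite mulrDr; apply: step_sumD => //.
have [k pk kE] := step_mul ss ss'.
have -> : (fun z => c z.1 * h z.2 * s z * (c' z.1 * h' z.2 * s' z)) =
  (fun z => c z.1 * c' z.1 * k z.1 * (h z.2 * h' z.2) * s z +
            c z.1 * c' z.1 * (1 - k z.1) * (h z.2 * h' z.2) * s' z).
  apply/funext => z.
  transitivity (c z.1 * c' z.1 * (h z.2 * h' z.2) * (s z * s' z)).
    by ring.
  by rewrite kE; ring.
have qhh := quasipolyM qh qh'; have pcc := pw_mul pc pc'.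
apply: step_sumD; first exact: (step_sum_atom (pw_mul pcc pk) qhh ss).
exact: (step_sum_atom (pw_mul pcc (pw_sub (pw_cst _ 1) pk)) qhh ss').
Qed.

Lemma step_sum_fst c : pw_quasipoly c -> step_sum (fun z => c z.1).
Proof.
move=> pc; have := step_sum_atom pc (quasipolyC 1) step1.
by under eq_fun do rewrite !mulr1.
Qed.

Lemma step_sum_snd h : quasipoly h -> step_sum (fun z => h z.2).
Proof.
move=> qh; have := step_sum_atom (pw_cst _ 1) qh step1.
by under eq_fun do rewrite mulr1 mul1r.
Qed.

Lemma step_sum_step s : step s -> step_sum s.
Proof.
move=> ss; have := step_sum_atom (pw_cst _ 1) (quasipolyC 1) ss.
by under eq_fun do rewrite !mul1r.
Qed.

(** Additivity determines the form on the second factor by its value at 1. *)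
Lemma additive_form_split (u : G * int -> int) : additive_form u ->
  exists v k, additive_form v /\ forall z, u z = v z.1 + k * z.2.
Proof.
move=> uD; exists (fun g => u (g, 0)), (u (0, 1)); split=> [x y|[g x] /=].
  by rewrite -uD; congr u; congr pair; rewrite addr0.
have u_nat (n : nat) : u (0, n%:Z) = u (0, 1) * n%:Z.
  elim: n => [|n IHn]; first by rewrite mulr0; exact: (additive_form0 uD).
  rewrite (_ : (0, n.+1%:Z) = (0, n%:Z) + (0, 1)) ?uD ?IHn; last first.
    by congr pair; rewrite /= ?addr0 // addrC.
  by rewrite [n.+1%:Z]intS; ring.
rewrite -[(g, x)](_ : (g, 0) + (0, x) = _); last first.
  by congr pair; rewrite /= ?addr0 ?add0r.
rewrite uD; congr (_ + _); case: (intP x) => [|n|n].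
- by rewrite u_nat.
- exact: u_nat.
- rewrite mulrN -u_nat -additive_formN //; congr u; congr pair.
  by rewrite /= oppr0.
Qed.

(** Lower bounds on the last coordinate are complements of upper bounds, and a
    congruence on [v g + k x] is split according to the residue of [v g]. *)
Lemma pw_step_sum F : pw_quasipoly F -> step_sum F.
Proof.
elim=> {F} [c|u uD|u K r uD K_gt0|u uD|F1 F2 _ IH1 _ IH2|F1 F2 _ IH1 _ IH2].
- exact: step_sum_fst (pw_cst _ c).
- have [v [k [vD uE]]] := additive_form_split uD.
  under eq_fun do rewrite uE rmorphD.
  apply: step_sumD; first exact: step_sum_fst (pw_form vD).
  apply: (@step_sum_snd (fun x => (k * x)%:~R)).
  under eq_fun do rewrite -[k * _]addr0.
  exact: (quasipoly_affine k 0 (quasipoly_id R)).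
- have [v [k [vD uE]]] := additive_form_split uD.
  pose F (i : 'I_K) z : R :=
    (K %| v z.1 - i%:Z)%Z%:R * (K %| k * z.2 + (i%:Z - r))%Z%:R.
  have -> : (fun z => (K %| u z - r)%Z%:R) =
      (fun z => \sum_(i <- index_enum 'I_K) F i z).
    apply/funext => -[g x]; rewrite uE /=.
    have [i0 [y vE]] := int_residue (v g) K_gt0.
    rewrite (bigD1 i0) //= big1 => [|i i_neq].
      rewrite addr0 /F /= vE dvdz_sub_residue eqxx mul1r.
      rewrite -!addrA rpredDl ?dvdz_mull //.
      by rewrite [k * x + _]addrCA.
    by rewrite /F /= vE dvdz_sub_residue (negPf i_neq) mul0r.
  apply: step_sum_bigop => i; apply: step_sumM.
    exact: (step_sum_fst (pw_dvd i%:Z vD K_gt0)).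
  exact: (step_sum_snd (quasipoly_dvd R k _ K_gt0)).
- have [v [k [vD uE]]] := additive_form_split uD.
  under eq_fun do rewrite uE.
  case: (intP k) uE => [|n|n] uE.
  + under eq_fun do rewrite mul0r addr0.
    exact: step_sum_fst (pw_le0 vD).
  + have -> : (fun z => '1[v z.1 + n.+1%:Z * z.2 <= 0] : R) =
      (fun z => '1[n.+1%:Z * z.2 < -1 * v z.1 ?<= if true]).
      by apply/funext => z; congr (nat_of_bool _)%:R => /=; lia.
    have vND := additive_formM (-1) vD.
    exact: (step_sum_step (step_lteif true (ltn0Sn n) vND)).
  + have -> : (fun z => '1[v z.1 + - n.+1%:Z * z.2 <= 0] : R) =
      (fun z => 1 + -1 * '1[n.+1%:Z * z.2 < v z.1 ?<= if false]).
      apply/funext => z; rewrite /= mulN1r.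
      have -> : (v z.1 + - n.+1%:Z * z.2 <= 0) =
          ~~ (n.+1%:Z * z.2 < v z.1) by lia.
      by case: (_ < _); rewrite ?subr0 ?subrr.
    apply: step_sumD; first exact: step_sum_fst (pw_cst _ 1).
    apply: step_sumM; first exact: step_sum_fst (pw_cst _ (-1)).
    exact: (step_sum_step (step_lteif false (ltn0Sn n) vD)).
- exact: step_sumD.
- exact: step_sumM.
Qed.

Lemma sum_antidifference (h H : int -> R) : (forall x, H (x + 1) - H x = h x) ->
  forall (x : int) (n : nat), \sum_(i < n) h (x + i%:Z) = H (x + n%:Z) - H x.
Proof.
move=> hH x; elim=> [|n IHn]; first by rewrite big_ord0 addr0 subrr.
rewrite big_ord_recr /= IHn -hH.
have -> : x + n%:Z + 1 = x + n.+1%:Z by lia.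
by ring.
Qed.

(** For one term with antidifference [H], the sum over [-w, w] is
    [H (t + 1) - H (- w)], where the last admitted value t is w, or the floor
    of a form divided by D, according to how the bound of the term compares
    with the ends of the interval. Whether w and -w satisfy the bound are
    homogeneous conditions. *)
Lemma pw_sum_interval F (w : G -> int) : pw_quasipoly F -> additive_form w ->
  exists2 f, pw_quasipoly f &
    forall g (m : nat), w g = m%:Z ->
      \sum_(i < m.*2.+1) F (g, i%:Z - m%:Z) = f g.
Proof.
move=> pF wD; elim: (pw_step_sum pF) => {F pF}.
  by exists (fun=> 0) => [|g m _]; [apply: pw_cst | rewrite big1].
move=> c h s F pc qh ss _ [f pf fE].
suff [f0 pf0 f0E] : exists2 f, pw_quasipoly f & forall g (m : nat),
    w g = m%:Z -> \sum_(i < m.*2.+1) h (i%:Z - m%:Z) * s (g, i%:Z - m%:Z) = f g.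
  exists (fun g => c g * f0 g + f g); first exact: pw_add (pw_mul pc pf0) pf.
  move=> g m wE; rewrite -(fE g m wE) -(f0E g m wE) mulr_sumr -big_split /=.
  by apply: eq_bigr => i _; rewrite mulrA.
have [H qH HE] := quasipoly_antidifference qh.
have sumH := sum_antidifference HE.
have sumE (n m : nat) :
    \sum_(i < n) h (i%:Z - m%:Z) = H (n%:Z - m%:Z) - H (- m%:Z).
  rewrite [n%:Z - _]addrC -sumH.
  by apply: eq_bigr => i _; rewrite addrC.
have pHN : pw_quasipoly (fun g => H (- w g)).
  have := quasipoly_form (quasipoly_affine (-1) 0 qH) wD.
  by under eq_fun do rewrite mulN1r addr0.
have pH1 : pw_quasipoly (fun g => H (w g + 1)).
  have := quasipoly_form (quasipoly_affine 1 1 qH) wD.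
  by under eq_fun do rewrite mul1r.
have pfull := pw_sub pH1 pHN.
case: ss => [|D u b D_gt0 uD].
  exists (fun g => H (w g + 1) - H (- w g)) => // g m wE.
  under eq_bigr do rewrite mulr1.
  by rewrite sumE wE; congr (H _ - _); lia.
(* The first value of the coordinate that violates the bound. *)
pose t (v : int) : int := ((v + (b%:Z - 1)) %/ D%:Z)%Z + 1.
have tP (x v : int) : (D%:Z * x < v ?<= if b) = (x < t v).
  rewrite /t ltzD1 lez_divRL //.
  by case: b {t} => /=; lia.
have pt : pw_quasipoly (fun g => H (t (u g))).
  apply: (quasipoly_form (h := fun v => H (t v)) _ uD).
  apply: (quasipoly_floor (h := fun v => H (v + 1)) _ D_gt0).
  have := quasipoly_affine 1 1 qH.
  by under eq_fun do rewrite mul1r.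
exists (fun g => '1[D%:Z * w g < u g ?<= if b] * (H (w g + 1) - H (- w g)) +
   (1 - '1[D%:Z * w g < u g ?<= if b]) *
   ('1[D%:Z * (-1 * w g) < u g ?<= if b] * (H (t (u g)) - H (- w g)))).
  have pA : pw_quasipoly (fun g => '1[D%:Z * w g < u g ?<= if b]).
    by apply: pw_lteif => //; apply: additive_formM.
  apply: pw_add; first exact: pw_mul.
  apply: pw_mul; first by apply: pw_sub => //; apply: pw_cst.
  apply: pw_mul; last exact: pw_sub.
  by apply: pw_lteif => //; do 2!apply: additive_formM.
move=> g m wE; rewrite /= wE !tP mulN1r.
under eq_bigr do rewrite tP.
case: (ltP m%:Z) => [mt|tm].
  rewrite mul1r subrr mul0r addr0.
  under eq_bigr => i _.
    rewrite (_ : (_ < _) = true) ?mulr1; last by have := ltn_ord i; lia.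
    over.
  by rewrite sumE; congr (H _ - _); lia.
rewrite mul0r add0r subr0 mul1r.
case: ltP => [mt|tm']; last first.
  rewrite mul0r big1 // => i _.
  by rewrite (_ : (_ < _) = false) ?mulr0 //; lia.
have [j tE] : exists j : nat, t (u g) = j%:Z - m%:Z.
  by exists (absz (t (u g) + m%:Z)); lia.
have j_le : (j <= m.*2.+1)%N by lia.
rewrite mul1r tE -sumE (big_ord_widen _ (fun i => h (i%:Z - m%:Z)) j_le).
rewrite [RHS]big_mkcond /=; apply: eq_bigr => i _.
have -> : (i%:Z - m%:Z < j%:Z - m%:Z) = (i < j)%N by lia.
by case: ifP; rewrite ?mulr1 ?mulr0.
Qed.

End Summation.
End Piecewise.

(** * Summation over boxes *)

Section BoxSum.
Variable R : realType.

(** Matrices over ['I_(2 m + 1)] encode the integer matrices with entries in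
    [-m, m]; being a finite type, they index the sums over boxes. *)
Definition recenter (m k l : nat) (A : 'M['I_(m.*2.+1)]_(k, l)) :
    'M[int]_(k, l) :=
  map_mx (fun i : 'I_(m.*2.+1) => i%:Z - m%:Z) A.

(** One coordinate is eliminated at a time; the bound N a is an additive form
    in the remaining variables, since a is one of them. *)
Lemma pw_sum_row (N k : nat) (f : 'rV[int]_k * int -> R) : pw_quasipoly f ->
  exists2 h : int -> R, pw_quasipoly h & forall a : nat,
    \sum_(v : 'rV['I_((N * a).*2.+1)]_k) f (recenter v, a%:Z) = h a%:Z.
Proof.
elim: k f => [|k IHk] f pf.
  exists (fun a => f (0, a)).
    apply: (pw_comp (phi := fun a : int => (0 : 'rV[int]_0, a)) _ pf) => x y.
    by congr pair; rewrite /= addr0.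
  move=> a; have card1 : #|{: 'rV['I_((N * a).*2.+1)]_0}| = 1%N.
    by rewrite card_mx muln0 expn0.
  have [v vP] := fintype1 card1.
  rewrite (big_pred1 v) => [|u]; last by rewrite [u]vP /= eqxx.
  by congr (f (_, _)); apply/rowP => -[].
pose cons (z : 'rV[int]_k * int * int) : 'rV[int]_k.+1 * int :=
  (row_mx (scalar_mx z.2 : 'M[int]_1) z.1.1 : 'rV_(1 + k), z.1.2).
have consD : {morph cons : x y / x + y}.
  move=> x y; congr pair => /=.
  by rewrite raddfD /= -add_row_mx.
have [f1 pf1 f1E] := pw_sum_interval (w := fun z => N%:Z * z.2)
  (pw_comp consD pf) (fun x y => mulrDr N%:Z x.2 y.2).
have [h ph hE] := IHk f1 pf1; exists h => // a.
rewrite -hE; set m := (N * a)%N.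
pose consI (p : 'I_(m.*2.+1) * 'rV['I_(m.*2.+1)]_k) : 'rV['I_(m.*2.+1)]_k.+1 :=
  row_mx (const_mx p.1 : 'M['I_(m.*2.+1)]_1) p.2 : 'rV_(1 + k).
rewrite (reindex consI) /=; last first.
  exists (fun v : 'rV_(1 + k) => (lsubmx v 0 0, rsubmx v)) => [[i v] _|v _] /=.
    by rewrite /consI row_mxKl row_mxKr mxE.
  apply: etrans (@hsubmxK _ 1 1 k v); congr row_mx.
  by apply/rowP => j; rewrite !ord1 mxE.
rewrite -(pair_bigA _ (fun i v => f (recenter (consI (i, v)), a%:Z))) /=.
rewrite exchange_big /=; apply: eq_bigr => v _.
rewrite -(f1E (recenter v, a%:Z) m); last by rewrite /m PoszM.
apply: eq_bigr => i _; congr (f (_, _)).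
pose shift (l : 'I_(m.*2.+1)) := l%:Z - m%:Z.
apply: (etrans (map_row_mx shift (const_mx i : 'M['I_(m.*2.+1)]_1) v)).
have -> : map_mx shift (const_mx i : 'M['I_(m.*2.+1)]_1) =
    scalar_mx (i%:Z - m%:Z).
  by apply/rowP => j; rewrite !mxE (ord1 j) mulr1n.
by [].
Qed.

Lemma pw_sum_matrix (N k l : nat) (f : 'M[int]_(k, l) * int -> R) :
  pw_quasipoly f ->
  exists2 h : int -> R, pw_quasipoly h & forall a : nat,
    \sum_(A : 'M['I_((N * a).*2.+1)]_(k, l)) f (recenter A, a%:Z) = h a%:Z.
Proof.
move=> pf; pose phi (z : 'rV[int]_(k * l) * int) := (vec_mx z.1, z.2).
have phiD : {morph phi : x y / x + y}.
  by move=> x y; congr pair; rewrite /= raddfD.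
have [h ph hE] := pw_sum_row N (pw_comp phiD pf).
exists h => // a; rewrite -hE (reindex (@vec_mx _ k l)) /=; last first.
  by apply: onW_bij; exists (@mxvec _ k l); [apply: vec_mxK | apply: mxvecK].
by apply: eq_bigr => v _; rewrite /phi /= /recenter map_vec_mx.
Qed.

(** For a > 0 the condition [u a <= 0] amounts to [u 1 <= 0], hence is
    constant. This is where homogeneity pays off. *)
Lemma pw_quasipoly_pos (f : int -> R) : pw_quasipoly f ->
  exists2 h, quasipoly h & forall a : nat, (0 < a)%N -> f a%:Z = h a%:Z.
Proof.
have formE (u : int -> int) : additive_form u -> forall a, u a = u 1 * a.
  move=> uD a; have u_nat (n : nat) : u n%:Z = u 1 * n%:Z.
    elim: n => [|n IHn]; first by rewrite mulr0; exact: (additive_form0 uD).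
    by rewrite intS uD IHn mulrDr mulr1.
  case: (intP a) => [|n|n]; [exact: u_nat 0%N | exact: u_nat |].
  by rewrite additive_formN // mulrN; congr (- _); apply: u_nat.
elim=> {f} [c|u uD|u K r uD K_gt0|u uD|f1 f2 _ [h1 q1 E1] _ [h2 q2 E2]
  |f1 f2 _ [h1 q1 E1] _ [h2 q2 E2]].
- by exists (fun=> c) => //; apply: quasipolyC.
- exists (fun a => (u 1 * a + 0)%:~R) => [|a _]; last by rewrite addr0 -formE.
  exact: (quasipoly_affine _ _ (quasipoly_id R)).
- exists (fun a => (K %| u 1 * a + (- r))%Z%:R) => [|a _]; last first.
    by rewrite -formE.
  exact: (quasipoly_dvd R (u 1) (- r) K_gt0).
- exists (fun=> (u 1 <= 0)%R%:R) => [|a a_gt0]; first exact: quasipolyC.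
  by rewrite formE // pmulr_lle0.
- exists (fun x => h1 x + h2 x); first exact: quasipolyD.
  by move=> a a_gt0; rewrite E1 ?E2.
- exists (fun x => h1 x * h2 x); first exact: quasipolyM.
  by move=> a a_gt0; rewrite E1 ?E2.
Qed.

End BoxSum.

(** * Definable conditions *)

Section Definable.
Variables (R : realType) (G : zmodType).
Implicit Types B : G -> bool.

(** These predicates form a Boolean algebra, because the indicators of
    conjunctions and negations are polynomials in the given indicators. *)
Definition definable B := pw_quasipoly (fun g => (B g)%:R : R).

Lemma definable_le0 u : additive_form u -> definable (fun g => u g <= 0).
Proof. exact: pw_le0. Qed.

Lemma eq_definable B1 B2 : B1 =1 B2 -> definable B1 -> definable B2.
Proof. by move=> /funext ->. Qed.

Lemma definableN B : definable B -> definable (fun g => ~~ B g).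
Proof.
move=> dB; have := pw_sub (pw_cst G 1) dB; rewrite /definable.
congr pw_quasipoly; apply/funext => g.
by case: (B g); rewrite ?subrr ?subr0.
Qed.

Lemma definable_and B1 B2 :
  definable B1 -> definable B2 -> definable (fun g => B1 g && B2 g).
Proof.
move=> d1 d2; rewrite /definable; under eq_fun do rewrite -mulnb natrM.
exact: pw_mul.
Qed.

Lemma definable_or B1 B2 :
  definable B1 -> definable B2 -> definable (fun g => B1 g || B2 g).
Proof.
move=> d1 d2.
have d12 := definableN (definable_and (definableN d1) (definableN d2)).
by apply: eq_definable d12 => g; rewrite negb_and !negbK.
Qed.

Lemma definable_all (I : Type) (s : seq I) (B : I -> G -> bool) :
  (forall i, definable (B i)) -> definable (fun g => all (B ^~ g) s).
Proof.
move=> dB; elim: s => [|i s IHs] /=; first exact: pw_cst.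
exact: definable_and.
Qed.

Lemma definable_forall (I : finType) (B : I -> G -> bool) :
  (forall i, definable (B i)) -> definable (fun g => [forall i, B i g]).
Proof.
move=> dB; apply: eq_definable (definable_all (enum I) dB) => g.
by apply/allP/forallP => H i; [apply: H; rewrite mem_enum | move=> _; apply: H].
Qed.

Lemma definable_exists (I : finType) (B : I -> G -> bool) :
  (forall i, definable (B i)) -> definable (fun g => [exists i, B i g]).
Proof.
move=> dB.
have dNB := definableN (definable_forall (fun i => definableN (dB i))).
by apply: eq_definable dNB => g; rewrite negb_forall; apply: eq_existsb => i;
   rewrite negbK.
Qed.

Lemma definable_eq0 u : additive_form u -> definable (fun g => u g == 0).
Proof.
move=> uD; apply: eq_definable (definable_and (definable_le0 uD)
  (definable_le0 (additive_formM (-1) uD))).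
by move=> g; rewrite mulN1r oppr_le0 -eq_le.
Qed.

Lemma definable_row_eq0 d (u : G -> 'rV[int]_d) : {morph u : x y / x + y} ->
  definable (fun g => u g == 0).
Proof.
move=> uD.
have dB j : definable (fun g => u g 0 j == 0).
  by apply: definable_eq0 => x y; rewrite uD mxE.
apply: eq_definable (definable_forall dB) => g.
apply/forallP/eqP => [u0|-> j]; last by rewrite mxE.
by apply/rowP => j; rewrite mxE; apply/eqP.
Qed.

End Definable.

Lemma definable_comp (R : realType) (G G' : zmodType) (phi : G' -> G)
    (B : G -> bool) :
  {morph phi : x y / x + y} -> definable R B -> definable R (B \o phi).
Proof. by move=> phiD; apply: pw_comp. Qed.

(** * Weyl's theorem by Fourier-Motzkin elimination *)

Section Weyl.
Variable R : realType.

Definition pairing k (y : 'rV[R]_k) (u : 'cV[int]_k) : R :=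
  (y *m map_mx intr u) 0 0.

Definition in_dual k (U : seq 'cV[int]_k) (y : 'rV[R]_k) :=
  all (fun u => pairing y u <= 0) U.

Lemma conical_hull_recl k m (w : 'I_m.+1 -> 'rV[R]_k) (y : 'rV[R]_k) :
  conical_hull w y <->
  exists2 t : R, 0 <= t & conical_hull (w \o lift ord0) (y - t *: w ord0).
Proof.
split=> [[c [c_ge0 ->]]|[t t_ge0 [c [c_ge0 yE]]]].
  exists (c ord0) => //; exists (c \o lift ord0); split=> [i|] /=.
    exact: c_ge0.
  by rewrite big_ord_recl addrC addKr.
exists (fun i => oapp c t (unlift ord0 i)); split=> [i|].
  by case: (unlift ord0 i) => [j|] //=.
rewrite big_ord_recl unlift_none /=; under eq_bigr do rewrite liftK /=.
by rewrite -yE addrC subrK.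
Qed.

(** Induction on the number of generators. A vector y is in the cone when
    [y - t w0] is in the cone on the other generators for some t >= 0. This is a
    system of linear inequalities in t with integer coefficients [c u], and t is
    eliminated by combining each lower bound (c p > 0, or t >= 0) with each
    upper bound (c q < 0). *)
Lemma weyl k m (w : 'I_m -> 'rV[int]_k) :
  exists U : seq 'cV[int]_k, forall y : 'rV[R]_k,
    conical_hull (fun i => map_mx intr (w i)) y <-> in_dual U y.
Proof.
elim: m w => [|m IHm] w.
  pose e (j : 'I_k) : 'cV[int]_k := delta_mx j 0.
  have eE (y : 'rV_k) j : pairing y (e j) = y 0 j.
    by rewrite /pairing map_delta_mx -colE mxE.
  have eNE (y : 'rV_k) j : pairing y (- e j) = - y 0 j.
    by rewrite /pairing raddfN mulmxN mxE -/(pairing y (e j)) eE.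
  have [s sP] : exists s : seq 'I_k, forall j, j \in s.
    by exists (enum 'I_k) => j; rewrite mem_enum.
  exists (map e s ++ map (fun j => - e j) s) => y; split.
    case=> c [_ ->]; rewrite big_ord0 /in_dual all_cat !all_map.
    apply/andP; split; apply/allP => j _ /=.
      by rewrite eE mxE.
    by rewrite eNE mxE oppr0.
  rewrite /in_dual all_cat !all_map => /andP[/allP le0 /allP ge0].
  exists (fun=> 0); split=> //; rewrite big_ord0; apply/rowP => j; rewrite mxE.
  have := le0 j (sP j); have := ge0 j (sP j).
  by rewrite /= eE eNE oppr_le0 => y_ge0 y_le0; apply/eqP; rewrite eq_le y_le0.
have [U UE] := IHm (w \o lift ord0).
pose c (u : 'cV[int]_k) : int := (w ord0 *m u) 0 0.
pose pos := [seq u <- U | 0 < c u]; pose neg := [seq u <- U | c u < 0].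
pose mixed := [seq c p *: q - c q *: p | p <- pos, q <- neg].
exists ([seq u <- U | c u <= 0] ++ mixed).
have cE u : pairing (map_mx intr (w ord0)) u = (c u)%:~R.
  by rewrite /pairing -map_mxM mxE.
have pairB (y : 'rV_k) t u :
    pairing (y - t *: map_mx intr (w ord0)) u = pairing y u - t * (c u)%:~R.
  by rewrite -cE /pairing mulmxBl -scalemxAl !mxE.
have pairC (y : 'rV_k) p q :
    pairing y (c p *: q - c q *: p) =
    (c p)%:~R * pairing y q - (c q)%:~R * pairing y p.
  by rewrite /pairing raddfB /= !map_mxZ mulmxBr -!scalemxAr !mxE.
move=> y; apply: (iff_trans (conical_hull_recl _ y)).
apply: (@iff_trans _ (exists2 t : R, 0 <= t &
    forall u, u \in U -> pairing y u <= t * (c u)%:~R)).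
  split=> -[t t_ge0 H]; exists t => //.
    move=> u uU; have /UE/allP/(_ u uU) := H.
    by rewrite pairB subr_le0.
  by apply/UE/allP => u uU; rewrite pairB subr_le0; apply: H.
split=> [[t t_ge0 H]|].
  apply/allP => u; rewrite mem_cat => /orP[|/allpairsP[[p q] /= [+ + ->]]].
    rewrite mem_filter => /andP[cu uU]; apply: le_trans (H u uU) _.
    by rewrite mulr_ge0_le0 // lerz0.
  rewrite !mem_filter => /andP[cp pU] /andP[cq qU].
  rewrite pairC subr_le0.
  have cp' : 0 < (c p)%:~R :> R by rewrite ltr0z.
  have cq' : (c q)%:~R < 0 :> R by rewrite ltrz0.
  have /(ler_wpM2l (ltW cp')) := H q qU; have /(ler_wnM2l (ltW cq')) := H p pU.
  move=> lep leq; apply: (le_trans leq); apply: le_trans lep.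
  by rewrite le_eqVlt; apply/orP; left; apply/eqP; ring.
rewrite /in_dual all_cat => /andP[/allP le0 /allP lepq].
(* The least t allowed by the lower bounds satisfies the upper ones. *)
pose t : R := \big[Num.max/0]_(p <- pos) (pairing y p / (c p)%:~R).
exists t; first by rewrite /t bigmax_idl le_max lexx.
move=> u uU; case: (ltgtP (c u) 0) => cu.
- have cu' : (c u)%:~R < 0 :> R by rewrite ltrz0.
  rewrite -ler_ndivlMr // /t big_seq; apply: bigmax_le.
    by rewrite ler_ndivlMr // mul0r le0 // mem_filter (ltW cu).
  move=> p; rewrite mem_filter => /andP[cp pU].
  have cp' : 0 < (c p)%:~R :> R by rewrite ltr0z.
  have /lepq : c p *: u - c u *: p \in mixed.
    by apply/allpairsP; exists (p, u); rewrite !mem_filter cp pU cu uU.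
  rewrite pairC subr_le0 ler_ndivlMr // => H.
  by rewrite mulrAC ler_pdivlMr // mulrC [X in _ <= X]mulrC.
- have cu' : 0 < (c u)%:~R :> R by rewrite ltr0z.
  rewrite -ler_pdivrMr //; apply: (@le_bigmax_seq _ _ _ _ 0 u xpredT
    (fun p => pairing y p / (c p)%:~R)) => //.
  by rewrite mem_filter cu.
- by rewrite cu mulr0 le0 // mem_filter cu lexx.
Qed.

End Weyl.

Lemma definable_in_dual (R : realType) (G : zmodType) k (U : seq 'cV[int]_k)
    (phi : G -> 'rV[int]_k) : {morph phi : x y / x + y} ->
  definable R (fun g => in_dual U (map_mx intr (phi g) : 'rV[R]_k)).
Proof.
move=> phiD.
have dU (u : 'cV[int]_k) : definable R (fun g => (phi g *m u) 0 0 <= 0).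
  by apply: definable_le0 => x y; rewrite phiD mulmxDl mxE.
apply: eq_definable (definable_all U dU) => g; apply: eq_all => u /=.
by rewrite /pairing -map_mxM [map_mx _ _ 0 0]mxE lerz0.
Qed.

(** * Rational cones and polytopes *)

Section Polytopes.
Local Open Scope classical_set_scope.
Variables (R : realType) (d : nat).
Implicit Types (C P : set 'rV[R]_d).

Lemma clear_denominators k (v : 'rV[rat]_k) :
  exists (D : nat) (w : 'rV[int]_k), (0 < D)%N /\
    map_mx ratr v = D%:R^-1 *: map_mx intr w :> 'rV[R]_k.
Proof.
pose D := (\prod_j absz (denq (v 0%R j)))%N.
have D_gt0 : (0 < D)%N.
  by apply: prodn_gt0 => j; rewrite absz_gt0 denq_neq0.
pose D' j := (\prod_(i < k | i != j) absz (denq (v 0%R i)))%N.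
exists D, (\row_j (numq (v 0 j) * (D' j)%:Z)); split=> //.
apply/rowP => j; rewrite !mxE /ratr rmorphM /=.
have denE : (denq (v 0 j))%:~R = (absz (denq (v 0%R j)))%:R :> R.
  by rewrite [RHS]pmulrn gez0_abs // denq_ge0.
have DE : D = (absz (denq (v 0%R j)) * D' j)%N by rewrite /D (bigD1 j).
have den_neq0 : (absz (denq (v 0%R j)))%:R != 0 :> R.
  by rewrite pnatr_eq0 absz_eq0 denq_neq0.
have D'_neq0 : (D' j)%:R != 0 :> R.
  by rewrite pnatr_eq0; move: D_gt0; rewrite DE; case: (D' j); rewrite ?muln0.
by rewrite DE natrM denE -[(D' j)%:~R]pmulrn; field; rewrite D'_neq0.
Qed.

Lemma sum_row_mx (I : Type) (s : seq I) k l
    (f : I -> 'rV[R]_k) (g : I -> 'rV[R]_l) :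
  \sum_(i <- s) row_mx (f i) (g i) =
  row_mx (\sum_(i <- s) f i) (\sum_(i <- s) g i).
Proof.
elim: s => [|i s IHs]; first by rewrite !big_nil row_mx0.
by rewrite !big_cons IHs add_row_mx.
Qed.

Definition homogenize (x : 'rV[R]_d) (a : R) : 'rV[R]_(d + 1) :=
  row_mx x (const_mx a).

(** For a > 0, x is in the dilate by a exactly when (x, a) is in the cone
    generated by the vectors (v, 1), v a vertex. Clearing the denominators of
    these vectors does not change the cone, and makes Weyl's theorem
    applicable. *)
Lemma dilate_in_dual P : rational_polytope P ->
  exists U : seq 'cV[int]_(d + 1), forall (x : 'rV[R]_d) (a : nat), (0 < a)%N ->
    dilate a%:R P x <-> in_dual U (homogenize x a%:R).
Proof.
case=> m [v ->].
have /choice[D /choice[w DwE]] := fun i => clear_denominators (v i).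
have [U UE] := weyl R
  (fun i => row_mx (w i) (const_mx (D i)%:Z) : 'rV[int]_(d + 1)).
exists U => x a a_gt0; rewrite -UE.
have a_neq0 : a%:R != 0 :> R by rewrite pnatr_eq0 -lt0n.
have D_gt0 i : 0 < (D i)%:R :> R by rewrite ltr0n; case: (DwE i).
have D_neq0 i : (D i)%:R != 0 :> R by rewrite gt_eqF.
have sumE (c : 'I_m -> R) :
    \sum_i c i *: map_mx intr (row_mx (w i) (const_mx (D i)%:Z)) =
    homogenize (\sum_i c i *: map_mx intr (w i)) (\sum_i c i * (D i)%:R).
  transitivity (\sum_i row_mx (c i *: map_mx intr (w i) : 'rV[R]_d)
      (const_mx (c i * (D i)%:R) : 'rV[R]_1)).
    apply: eq_bigr => i _; rewrite map_row_mx scale_row_mx; congr row_mx.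
    by rewrite map_const_mx; apply/rowP => j; rewrite !mxE.
  rewrite sum_row_mx; congr row_mx; apply/rowP => j; rewrite summxE mxE.
  by apply: eq_bigr => i _; rewrite mxE.
split=> [[_ [c [c_ge0 c1 ->]] <-]|[c [c_ge0]]].
  exists (fun i => a%:R * c i / (D i)%:R); split=> [i|].
    by rewrite !mulr_ge0 ?invr_ge0.
  rewrite sumE; congr homogenize.
    rewrite scaler_sumr; apply: eq_bigr => i _.
    by case: (DwE i) => _ ->; rewrite !scalerA.
  under eq_bigr do rewrite mulfVK //.
  by rewrite -mulr_sumr c1 mulr1.
rewrite sumE => /eq_row_mx[-> /rowP/(_ 0)]; rewrite !mxE => aE.
exists (\sum_i (c i * (D i)%:R / a%:R) *: map_mx ratr (v i)).
  exists (fun i => c i * (D i)%:R / a%:R); split=> // [i|].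
    by rewrite !mulr_ge0 ?invr_ge0.
  by rewrite -mulr_suml -aE mulfV.
rewrite scaler_sumr; apply: eq_bigr => i _; case: (DwE i) => _ ->.
by rewrite !scalerA; congr (_ *: _); field; rewrite a_neq0 D_neq0.
Qed.

Lemma polytope_bounded P : rational_polytope P ->
  exists N : nat, forall x j, P x -> `|x 0 j| <= N%:R.
Proof.
case=> m [v ->].
pose B : R := \sum_i \sum_j `|(map_mx ratr (v i) : 'rV[R]_d) 0 j|.
have B_ge0 : 0 <= B by apply: sumr_ge0 => i _; apply: sumr_ge0.
exists (Num.bound B) => _ j [c [c_ge0 c1 ->]].
apply: le_trans (ltW (archi_boundP B_ge0)).
rewrite summxE; apply: le_trans (ler_norm_sum _ _ _) _.
apply: ler_sum => i _; rewrite mxE normrM ger0_norm //.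
have c_le1 : c i <= 1.
  by rewrite -c1 (bigD1 i) //= lerDl sumr_ge0.
apply: le_trans (ler_wpM2r (normr_ge0 _) c_le1) _.
by rewrite mul1r (bigD1 j) //= lerDl sumr_ge0.
Qed.

Definition convex_cone C := [/\ C 0, forall x y, C x -> C y -> C (x + y)
  & forall t x, 0 <= t -> C x -> C (t *: x)].

Lemma rational_cone_convex C : rational_cone C -> convex_cone C.
Proof.
case=> m [v ->]; split.
- by exists (fun=> 0); split=> //; rewrite big1 // => i _; rewrite scale0r.
- move=> _ _ [c [c_ge0 ->]] [c' [c'_ge0 ->]]; exists (fun i => c i + c' i).
  split=> [i|]; first exact: addr_ge0.
  by rewrite -big_split; apply: eq_bigr => i _; rewrite scalerDl.
- move=> t _ t_ge0 [c [c_ge0 ->]]; exists (fun i => t * c i).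
  split=> [i|]; first exact: mulr_ge0.
  by rewrite scaler_sumr; apply: eq_bigr => i _; rewrite scalerA.
Qed.

Lemma sum_in_cone C (I : Type) (s : seq I) (F : I -> 'rV[R]_d) :
  convex_cone C -> (forall i, C (F i)) -> C (\sum_(i <- s) F i).
Proof. by case=> C0 CD _ CF; elim/big_ind: _ => // x y; apply: CD. Qed.

Lemma maxr_subN (t : R) : Num.max t 0 - Num.max (- t) 0 = t.
Proof.
case: (leP 0 t) => t0.
  by rewrite max_r ?subr0 // oppr_le0.
by rewrite max_l ?opprK ?add0r // oppr_ge0 ltW.
Qed.

(** Every vector, in particular each basis vector e_j, is a difference
    y_j - z_j of elements of C. Take u to be the sum of all y_j and z_j: adding
    a small multiple of e_j only changes the coefficients of y_j and z_j, which
    remain nonnegative. *)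
Lemma full_cone_interior C : convex_cone C -> full_dimensional C ->
  exists u, forall (s : R) (e : 'rV[R]_d), 0 <= s ->
    (forall j, `|e 0 j| <= s) -> C (s *: u + e).
Proof.
move=> Ccone Cfull; have [C0 CD CZ] := Ccone.
have diff x : exists y z, [/\ C y, C z & x = y - z].
  have [X [XC xX]] := Cfull x.
  have {}XC i : C (in_tuple X)`_i.
    have [iX|iX] := ltnP i (size X); first by apply: XC; rewrite mem_nth.
    by rewrite nth_default.
  rewrite (coord_span (X := in_tuple X) xX).
  pose k i := coord (in_tuple X) i x.
  exists (\sum_i Num.max (k i) 0 *: (in_tuple X)`_i).
  exists (\sum_i Num.max (- k i) 0 *: (in_tuple X)`_i).
  split; try by apply: sum_in_cone => // i; apply: CZ => //;
    rewrite le_max lexx orbT.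
  rewrite -sumrB; apply: eq_bigr => i _; rewrite -scalerBl; congr (_ *: _).
  by rewrite maxr_subN.
have /choice[y /choice[z yzE]] := fun j => diff (delta_mx 0 j).
exists (\sum_j (y j + z j)) => s e s_ge0 es.
have -> : s *: (\sum_j (y j + z j)) + e =
    \sum_j ((s + e 0 j) *: y j + (s - e 0 j) *: z j).
  rewrite {1}[e]row_sum_delta scaler_sumr -big_split; apply: eq_bigr => j _ /=.
  case: (yzE j) => _ _ ->; rewrite !scalerDl scalerDr scaleNr scalerBr.
  by rewrite addrACA.
apply: sum_in_cone => // j; case: (yzE j) => Cy Cz _.
have := es j; rewrite ler_norml => /andP[e1 e2].
by apply: CD; apply: CZ => //; lra.
Qed.

Lemma within_coordinates C P : within C (nbhs (0 : 'rV[R]_d)) P ->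
  exists2 e : R, 0 < e & forall x, C x -> (forall j, `|x 0 j| <= e) -> P x.
Proof.
move=> /nbhs_ballP[e /= e_gt0 eP]; exists (e / 2); first by rewrite divr_gt0.
move=> x Cx xe; apply: eP => //; split=> // i j; rewrite /ball /= mxE.
by rewrite sub0r normrN ord1; apply: le_lt_trans (xe j) _;
   rewrite ltr_pdivrMr // ltr_pMr // ltr1n.
Qed.

End Polytopes.

(** * A cube whose sums leave the polytope *)

Definition int_vec (R : realType) (d : nat) (x : 'rV[int]_d) : 'rV[R]_d :=
  map_mx intr x.

Section Region.
Local Open Scope classical_set_scope.
Variables (R : realType) (d : nat) (C P : set 'rV[R]_d).
Hypotheses (d_gt0 : (0 < d)%N) (C_rational : rational_cone C)
  (C_pointed : pointed_cone C) (C_full : full_dimensional C)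
  (P_compatible : compatible C P).

Let Ccone := rational_cone_convex C_rational.

Lemma compatible_outside x y : C x -> ~ P x -> C y -> ~ P (x + y).
Proof.
move=> Cx Px Cy; case: P_compatible => _ _ Pout.
by have [] : (C `\` P) (x + y) by apply: (Pout x (conj Cx Px)); exists y.
Qed.

Lemma compatible_outside_scale (t t' : R) u : C u -> 0 <= t -> t <= t' ->
  ~ P (t *: u) -> ~ P (t' *: u).
Proof.
case: Ccone => _ _ CZ Cu t_ge0 tt' Ptu.
rewrite -(subrK t t') addrC scalerDl.
by apply: compatible_outside => //; apply: CZ; rewrite ?subr_ge0.
Qed.

(** Take a ray through an interior point u of C. As P is bounded and contains a
    neighborhood of 0 in C, some t1 > 0 satisfies t1 u \in P and
    (3/2) t1 u \notin P. Points near (7/8) t1 u precede t1 u in the order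
    defined by C, so compatibility puts them in P; sums of two such points are
    near (7/4) t1 u, hence beyond (3/2) t1 u and outside P. *)
Lemma sum_free_ball : exists (x0 : 'rV[R]_d) (e : R),
  [/\ 0 < e,
      forall x : 'rV[R]_d, (forall j, `|x 0 j - x0 0 j| <= e) -> C x /\ P x
    & forall x y : 'rV[R]_d, (forall j, `|x 0 j - x0 0 j| <= e) ->
        (forall j, `|y 0 j - x0 0 j| <= e) -> ~ P (x + y)].
Proof.
have [C0 CD CZ] := Ccone; have [P_rational P_nbhs _] := P_compatible.
have [u uP] := full_cone_interior Ccone C_full.
have Cu : C u.
  have := uP 1 0 ler01; rewrite scale1r addr0; apply=> j.
  by rewrite mxE normr0.
have [j0 uj0] : exists j, u 0 j != 0.
  apply: contrapT => /forallNP u0.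
  have {}u0 : u = 0.
    apply/rowP => j; rewrite mxE; apply/eqP.
    by apply: contrapT => /negP; apply: u0.
  have Ce (b : bool) : C ((-1) ^+ b *: delta_mx 0 (Ordinal d_gt0)).
    rewrite -[X in C X]add0r -[X in X + _](scaler0 _ 1) -u0; apply: uP => // j.
    rewrite mxE normrM normrX normrN1 expr1n mul1r mxE.
    by case: (_ && _); rewrite ?normr1 ?normr0.
  have := C_pointed (Ce false); rewrite expr0 scale1r -scaleN1r.
  move=> /(_ (Ce true)) /matrixP/(_ 0 (Ordinal d_gt0)) /eqP.
  by rewrite !mxE !eqxx oner_eq0.
have [e e_gt0 eP] := within_coordinates P_nbhs.
have [N NP] := polytope_bounded P_rational.
pose M := 1 + \sum_j `|u 0 j|.
have M_gt0 : 0 < M by rewrite ltr_wpDr ?sumr_ge0.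
pose t0 := e / M / 2; have t0_gt0 : 0 < t0 by rewrite !divr_gt0.
have P2t0 : P ((2%:R * t0) *: u).
  have t0E : 2%:R * t0 = e / M by rewrite /t0; field; rewrite gt_eqF.
  have eM_ge0 : 0 <= e / M by rewrite divr_ge0 // ltW.
  rewrite t0E; apply: eP => [|j]; first exact: CZ.
  rewrite mxE normrM (ger0_norm eM_ge0) mulrAC ler_pdivrMr //.
  rewrite ler_wpM2l ?(ltW e_gt0) // /M (bigD1 j) //= addrCA lerDl.
  by rewrite addr_ge0 ?sumr_ge0.
(* t1 is the last multiple k t0, k >= 2, that stays in P: the next multiple is
   then at most (3/2) t1. *)
have exk : exists k : nat, `[< ~ P ((k.+2%:R * t0) *: u) >].
  pose T := (N%:R + 1) / `|u 0 j0|.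
  have T_ge0 : 0 <= T by rewrite divr_ge0 // addr_ge0.
  exists (Num.bound (T / t0)); apply/asboolP.
  apply: (@compatible_outside_scale T) => //.
    rewrite -ler_pdivrMr //; apply: ltW.
    apply: lt_le_trans (archi_boundP _) _; first by rewrite divr_ge0 // ltW.
    by rewrite ler_nat leqW.
  move=> /(NP _ j0); rewrite mxE normrM ger0_norm // /T mulfVK ?normr_eq0 //.
  by rewrite gerDl ler10.
case: (ex_minnP exk) => -[|k] /asboolP Pk kmin; first by [].
pose t1 := k.+2%:R * t0; have t1_gt0 : 0 < t1 by rewrite mulr_gt0.
have Pt1 : P (t1 *: u).
  by apply: contrapT => Pt1; have := kmin k; rewrite ltnn => H; apply: notF;
     apply: H; apply/asboolP.
have P3t1 : ~ P ((3 / 2 * t1) *: u).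
  apply: compatible_outside_scale Pk => //; first by rewrite mulr_ge0 // ltW.
  rewrite /t1 [X in _ <= X]mulrA ler_wpM2r ?(ltW t0_gt0) //.
  by rewrite -(addn3 k) -(addn2 k) !natrD; have := ler0n R k; lra.
exists ((7 / 8 * t1) *: u), (t1 / 8); split; first by rewrite divr_gt0.
  move=> x xe; have Cx : C x.
    rewrite -[x](subrK ((7 / 8 * t1) *: u)) addrC.
    have -> : 7 / 8 * t1 = t1 / 8 + 6 / 8 * t1 by lra.
    rewrite {1}scalerDl addrAC; apply: CD; last by apply: CZ => //; lra.
    apply: uP => [|j]; first by lra.
    have := xe j; rewrite !mxE.
    by have -> : 7 / 8 * t1 = t1 / 8 + 6 / 8 * t1 by lra.
  split=> //; apply: contrapT => Px.
  suff /(compatible_outside Cx Px) : C (t1 *: u - x) by rewrite addrC subrK.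
  have -> : t1 *: u - x = (t1 / 8) *: u + ((7 / 8 * t1) *: u - x).
    by rewrite addrA -scalerDl; congr (_ *: _ - _); lra.
  apply: uP => [|j]; first by lra.
  by rewrite [X in `|X|]mxE [X in _ + X]mxE distrC.
move=> x y xe ye.
have Ct : C ((3 / 2 * t1) *: u) by apply: CZ => //; lra.
suff /(compatible_outside Ct P3t1) : C (x + y - (3 / 2 * t1) *: u).
  by rewrite addrC subrK.
have -> : x + y - (3 / 2 * t1) *: u = (t1 / 4) *: u +
    ((x - (7 / 8 * t1) *: u) + (y - (7 / 8 * t1) *: u)).
  apply/rowP => j; rewrite !mxE; lra.
apply: uP => [|j]; first by lra.
rewrite mxE; apply: le_trans (ler_normD _ _) _.
have := xe j; have := ye j; rewrite !mxE; lra.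
Qed.

Lemma dilateE (a : R) x : 0 < a -> dilate a P x <-> P (a^-1 *: x).
Proof.
move=> a_gt0; split=> [[y Py <-]|Px].
  by rewrite scalerA mulVf ?scale1r // gt_eqF.
by exists (a^-1 *: x) => //; rewrite scalerA mulfV ?scale1r // gt_eqF.
Qed.

(** A ball contains a cube of side n / L with integral corner z / L, once L is
    large. After dilation by L k the cube has side n k and integral corner k z:
    there is room for n disjoint blocks of k^d lattice points. *)
Lemma sum_free_cube (n : nat) : exists (L : nat) (z : 'rV[int]_d), (0 < L)%N /\
  forall k : nat, (0 < k)%N ->
    let cube (x : 'rV[int]_d) := forall j,
      k%:Z * z 0 j <= x 0 j <= k%:Z * z 0 j + (n * k)%N%:Z in
    (forall x, cube x ->
       C (int_vec R x) /\ dilate (L * k)%:R P (int_vec R x)) /\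
    (forall x y, cube x -> cube y -> ~ dilate (L * k)%:R P (int_vec R (x + y))).
Proof.
have [x0 [e [e_gt0 CP sumP]]] := sum_free_ball.
pose L := (Num.bound (n.+1%:R / e)).+1.
have LE : n.+1%:R <= L%:R * e.
  rewrite -ler_pdivrMr //; apply: ltW; apply: lt_trans (archi_boundP _) _.
    by rewrite divr_ge0 // ltW.
  by rewrite ltr_nat.
exists L, (\row_j Num.floor (L%:R * x0 0 j)); split=> // k k_gt0 cube.
have Lk_gt0 : 0 < (L * k)%:R :> R by rewrite ltr0n muln_gt0.
have near x : cube x ->
    forall j, `|((L * k)%:R^-1 *: int_vec R x) 0 j - x0 0 j| <= e.
  move=> xP j; have := xP j; rewrite !mxE => /andP[].
  set f := Num.floor _.
  have /andP[f1 /ltW] := floor_itv (L%:R * x0 0 j); rewrite -/f intrD1 => f2.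
  rewrite -(ler_int R) -[(_ <= _ + _)](ler_int R) rmorphD /= !rmorphM /=.
  rewrite -!pmulrn => x1 x2.
  have k_gt0' : 0 < k%:R :> R by rewrite ltr0n.
  have -> : (L * k)%:R^-1 * (x 0 j)%:~R - x0 0 j =
      (L * k)%:R^-1 * ((x 0 j)%:~R - k%:R * (L%:R * x0 0 j)).
    by rewrite natrM; field; rewrite !gt_eqF // ltr0n.
  rewrite normrM ger0_norm ?invr_ge0 ?(ltW Lk_gt0) // mulrC ler_pdivrMr //.
  have H1 := ler_wpM2l (ltW k_gt0') f1; have H2 := ler_wpM2l (ltW k_gt0') f2.
  have H3 := ler_wpM2l (ltW k_gt0') LE.
  rewrite natrM [e * _]mulrC -mulrA mulrCA; rewrite -natr1 in H3.
  rewrite mulrDr in H2; rewrite mulrDr in H3.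
  have n_ge0 : 0 <= k%:R * n%:R :> R by rewrite mulr_ge0.
  by rewrite ler_norml; apply/andP; split; rewrite [n%:R * _]mulrC in x2; lra.
have [C0 CD CZ] := Ccone; split=> [x cx|x y cx cy].
  have [Cx Px] := CP _ (near x cx); split; last by apply/dilateE.
  rewrite -[int_vec R x]scale1r -(mulfV (lt0r_neq0 Lk_gt0)) -scalerA.
  by apply: CZ; rewrite // ltW.
move=> /(dilateE _ Lk_gt0); rewrite /int_vec map_mxD scalerDr.
by apply: sumP; apply: near.
Qed.

End Region.

(** * Semigroups as finite sets of lattice points *)

Section Cardinality.
Local Open Scope card_scope.
Local Open Scope classical_set_scope.

Lemma card_eq_uniq (T : eqType) (s : seq T) : uniq s -> [set` s] #= `I_(size s).
Proof.
case: s => [|x s'] us; first by rewrite set_nil II0.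
set s := x :: s' in us *.
have <- : nth x s @` `I_(size s) = [set` s].
  apply/seteqP; split=> [_ [i /= i_lt <-]|y /= /(nthP x)[i i_lt <-]].
    exact: mem_nth.
  by exists i.
apply: inj_card_eq => i j; rewrite !inE /= => i_lt j_lt.
by move/eqP; rewrite nth_uniq // => /eqP.
Qed.

Lemma card_eq_finset (T : finType) (A : {set T}) : [set` A] #= `I_#|A|.
Proof.
have -> : [set` A] = [set` enum A].
  by apply/seteqP; split=> x /=; rewrite mem_enum.
by rewrite cardE; apply: card_eq_uniq; apply: enum_uniq.
Qed.

End Cardinality.

Section Counting.
Local Open Scope card_scope.
Local Open Scope classical_set_scope.
Variables (R : realType) (d : nat) (C P : set 'rV[R]_d).
Local Notation int_vec := (int_vec R (d := d)).
Variables (inC : pred 'rV[int]_d) (inP : 'rV[int]_d -> int -> bool) (N : nat).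
Hypotheses
  (Ccone : convex_cone C) (C_pointed : pointed_cone C)
  (C_int : forall x, C (int_vec x) <-> inC x)
  (P_int : forall x (a : nat), (0 < a)%N ->
     dilate a%:R P (int_vec x) <-> inP x a%:Z)
  (P_bounded : forall x j, P x -> `|x 0 j| <= N%:R)
  (P0 : P 0)
  (P_out : forall x y, C x -> ~ P x -> C y -> ~ P (x + y)).

(** The conditions under which the elements of s, together with 0 and the
    lattice points of the cone outside the dilate, form a semigroup. *)
Definition admissible (a : int) (s : seq 'rV[int]_d) :=
  all (fun x => [&& inC x, inP x a & x != 0]) s &&
  all (fun x => all (fun y => ~~ inP (x + y) a || (x + y \in s)) s) s.

Lemma eq_admissible a s s' : s =i s' -> admissible a s = admissible a s'.
Proof.
move=> ss'; rewrite /admissible; congr (_ && _); first exact: eq_all_r.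
rewrite (eq_all_r ss'); apply: eq_all => x.
by rewrite (eq_all_r ss'); apply: eq_all => y; rewrite ss'.
Qed.

Definition dilate_semigroups (n a : nat) : set (set 'rV[R]_d) :=
  [set S | [/\ C_semigroup C S, (S `&` dilate a%:R P) #= `I_n.+1
             & gaps C S `<=` dilate a%:R P]].

Lemma recenter_inj m k l : injective (@recenter m k l).
Proof.
move=> A B /matrixP AB; apply/matrixP => i j; have := AB i j.
by rewrite !mxE => ?; apply/val_inj/eqP; rewrite /= -eqz_nat; lia.
Qed.

Lemma recenter_surj m k l (A : 'M[int]_(k, l)) :
  (forall i j, `|A i j| <= m%:Z) ->
  exists B : 'M['I_(m.*2.+1)]_(k, l), recenter B = A.
Proof.
move=> Am; exists (\matrix_(i, j) inord (absz (A i j + m%:Z)%R)).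
apply/matrixP => i j; rewrite !mxE; have := Am i j => ?.
by rewrite inordK; lia.
Qed.

Lemma int_vec_inj : injective int_vec.
Proof.
move=> x y /rowP xy; apply/rowP => j; have := xy j.
by rewrite !mxE => /intr_inj.
Qed.

Lemma int_vecD x y : int_vec (x + y) = int_vec x + int_vec y.
Proof. exact: map_mxD. Qed.

Lemma int_vec0 : int_vec 0 = 0.
Proof. exact: map_mx0. Qed.

Section Dilate.
Variables (n a : nat).
Hypothesis a_gt0 : (0 < a)%N.

Local Notation m := (N * a)%N.
Local Notation T := ('rV['I_(m.*2.+1)]_d).
Let pt (v : T) : 'rV[int]_d := recenter v.
Let aP := dilate a%:R P.

Let a_gt0' : 0 < a%:R :> R. Proof. by rewrite ltr0n. Qed.

Lemma dilate_bounded x j : aP (int_vec x) -> `|x 0 j| <= m%:Z.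
Proof.
move=> aPx.
have := P_bounded j ((iffLR (dilateE P (int_vec x) a_gt0')) aPx).
rewrite !mxE normrM ger0_norm ?invr_ge0 // mulrC ler_pdivrMr //.
by rewrite -natrM -intr_norm pmulrn ler_int.
Qed.

Lemma dilate_surj x : aP (int_vec x) -> exists v : T, pt v = x.
Proof.
by move=> aPx; apply: recenter_surj => i j; rewrite ord1; apply: dilate_bounded.
Qed.

Lemma dilate_out x y : C x -> ~ aP x -> C y -> ~ aP (x + y).
Proof.
case: Ccone => _ _ CZ Cx aPx Cy /dilateE -/(_ a_gt0'); rewrite scalerDr.
have a_ge0 : 0 <= a%:R^-1 :> R by rewrite invr_ge0.
apply: P_out; [exact: CZ | | exact: CZ].
by move=> Px; apply: aPx; apply/dilateE.
Qed.

Definition points (A : {set T}) := [seq pt v | v <- enum A].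

Lemma mem_points A v : (pt v \in points A) = (v \in A).
Proof. by rewrite mem_map ?mem_enum //; apply: recenter_inj. Qed.

Definition semigroup_of_points (A : {set T}) : set 'rV[R]_d :=
  [set x | [\/ x = 0, exists2 y, y \in points A & x = int_vec y
             | [/\ C x, @lattice R d x & ~ aP x]]].

Definition good_sets : {set {set T}} :=
  [set A : {set T} | (#|A| == n) && admissible a (points A)]%SET.

Lemma aP0 : aP 0.
Proof. by exists 0; rewrite ?scaler0. Qed.

Lemma semigroup_of_points_trace A :
  (forall y, y \in points A -> aP (int_vec y) /\ y != 0) ->
  semigroup_of_points A `&` aP = int_vec @` [set` 0 :: points A] /\
  (semigroup_of_points A `&` aP) #= `I_#|A|.+1.
Proof.
move=> AP.
have traceE : semigroup_of_points A `&` aP = int_vec @` [set` 0 :: points A].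
  apply/seteqP; split=> [x [[->|[y yA ->]|[_ _ aPx]] aPx']|].
  - by exists 0; rewrite ?int_vec0 //= mem_head.
  - by exists y; rewrite //= in_cons yA orbT.
  - by [].
  move=> _ [y /= + <-]; rewrite in_cons => /predU1P[->|yA].
    by rewrite int_vec0; split; [constructor 1 | apply: aP0].
  by have [? _] := AP y yA; split=> //; constructor 2; exists y.
split=> //; rewrite traceE.
have us : uniq (0 :: points A).
  rewrite /= (map_inj_uniq (@recenter_inj _ _ _)) enum_uniq andbT.
  by apply/negP => /AP[_]; rewrite eqxx.
have -> : #|A|.+1 = size (0 :: points A) by rewrite /= size_map -cardE.
rewrite -(card_eqr (card_eq_uniq us)); apply: inj_card_eq => x y _ _.
exact: int_vec_inj.
Qed.

Lemma good_setP A y : A \in good_sets -> y \in points A ->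
  [/\ C (int_vec y), aP (int_vec y) & y != 0].
Proof.
rewrite inE => /andP[_ /andP[/allP H _]] /H /and3P[? ? ?].
by split=> //; [apply/C_int | apply/P_int].
Qed.

Lemma int_vec_lattice x : @lattice R d (int_vec x).
Proof. by exists x. Qed.

Lemma lattice_dilate_finite : finite_set (@lattice R d `&` aP).
Proof.
apply: (@sub_finite_set _ _ ((fun v => int_vec (pt v)) @` setT)).
  by move=> _ [[x _ <-] /dilate_surj[v vE]]; exists v; rewrite ?vE.
by apply: finite_image; apply: finite_finset.
Qed.

Lemma semigroup_of_points_dilate A :
  A \in good_sets -> dilate_semigroups n a (semigroup_of_points A).
Proof.
have [C0 CD CZ] := Ccone.
move=> Agood; have AP := good_setP Agood.
have subC : semigroup_of_points A `<=` C `&` @lattice R d.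
  move=> x [->|[y /AP[Cy _ _] ->]|[Cx Lx _]]; split=> //; last first.
    exact: int_vec_lattice.
  by rewrite -int_vec0; apply: int_vec_lattice.
have gapP : gaps C (semigroup_of_points A) `<=` aP.
  move=> x [[Cx Lx] Sx]; apply: contrapT => aPx; apply: Sx.
  by constructor 3.
split=> //.
  split=> //; first by constructor 1.
    move=> x y Sx Sy; have [Cx Lx] := subC x Sx; have [Cy Ly] := subC y Sy.
    have Lxy : @lattice R d (x + y).
      by case: Lx Ly => [x' _ <-] [y' _ <-]; exists (x' + y'); rewrite ?map_mxD.
    have [aPxy|aPxy] := pselect (aP (x + y)); last first.
      by constructor 3; split=> //; apply: CD.
    case: Sx => [->|[x' x'A xE]|[_ _ aPx]]; first by rewrite add0r.
      case: Sy => [->|[y' y'A yE]|[_ _ aPy]].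
      - by rewrite addr0; constructor 2; exists x'.
      - constructor 2; exists (x' + y'); last by rewrite int_vecD xE yE.
        move: aPxy; rewrite xE yE -int_vecD => /(P_int _ a_gt0) aPxy.
        move: Agood; rewrite inE => /andP[_ /andP[_ /allP/(_ x' x'A)/allP]].
        by move=> /(_ y' y'A); rewrite aPxy.
      - by case: (dilate_out Cy aPy Cx); rewrite addrC.
    by case: (dilate_out Cx aPx Cy).
  apply: sub_finite_set lattice_dilate_finite => x gx; split; last exact: gapP.
  by case: gx => -[].
have [|_] := @semigroup_of_points_trace A; last first.
  by move: Agood; rewrite inE => /andP[/eqP ->].
by move=> y /AP[].
Qed.

(** Pointedness enters here: a sum of two nonzero elements of the cone is
    nonzero, so that it is in A as soon as it is in the dilate. *)
Lemma dilate_semigroup_points S :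
  dilate_semigroups n a S ->
  exists2 A, A \in good_sets & semigroup_of_points A = S.
Proof.
move=> [[Ssub S0 SD Sfin] Scard Sgap].
pose A : {set T} :=
  [set v | [&& `[< S (int_vec (pt v)) >], inP (pt v) a & pt v != 0]]%SET.
have AP y : (y \in points A) <-> [/\ S (int_vec y), aP (int_vec y) & y != 0].
  split=> [/mapP[v]|[Sy aPy y0]].
    rewrite mem_enum inE => /and3P[/asboolP Sv vP v0 ->].
    by split=> //; apply/P_int.
  have [v vE] := dilate_surj aPy; apply/mapP; exists v => //.
  rewrite mem_enum inE vE y0 andbT; apply/andP; split; first exact/asboolP.
  exact/P_int.
have SE : semigroup_of_points A = S.
  apply/seteqP; split=> [x [->|[y /AP[Sy _ _] ->]|[Cx Lx aPx]]|x Sx] //.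
    by apply: contrapT => Sx; apply: aPx; apply: Sgap.
  have [Cx [y _ yE]] := Ssub x Sx; rewrite -yE -/(int_vec y) in Sx Cx *.
  have [->|y0] := eqVneq y 0; first by constructor 1; apply: int_vec0.
  have [aPy|aPy] := pselect (aP (int_vec y)).
    by constructor 2; exists y => //; apply/AP; split.
  by constructor 3; split=> //; apply: int_vec_lattice.
exists A => //; rewrite inE; apply/andP; split.
  have [|_] := @semigroup_of_points_trace A; first by move=> y /AP[].
  rewrite SE => Scard'; apply/eqP/succn_inj/card_eq_II.
  by rewrite -(card_eqr Scard) card_esym // Scard'.
apply/andP; split; apply/allP => x /AP[Sx aPx x0].
  rewrite x0 andbT; apply/andP; split; last exact/P_int.
  by apply/C_int; case: (Ssub _ Sx).
apply/allP => y /AP[Sy aPy y0]; rewrite -implybE; apply/implyP => xyP.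
apply/AP; split; first by rewrite int_vecD; apply: SD.
  exact/P_int.
apply: contra x0 => /eqP xy0; apply/eqP/int_vec_inj; rewrite int_vec0.
apply: C_pointed; first by case: (Ssub _ Sx).
suff <- : int_vec y = - int_vec x by case: (Ssub _ Sy).
by apply/eqP; rewrite -addr_eq0 addrC -int_vecD xy0 int_vec0.
Qed.

Lemma card_dilate_semigroups : dilate_semigroups n a #= `I_#|good_sets|.
Proof.
have -> : dilate_semigroups n a = semigroup_of_points @` [set` good_sets].
  apply/seteqP; split=> [S /dilate_semigroup_points[A]|_ [A Agood <-]].
    by exists A.
  exact: semigroup_of_points_dilate.
rewrite -(card_eqr (card_eq_finset good_sets)).
apply: inj_card_eq => A B; rewrite !inE /= => Agood Bgood AB; apply/setP => v.
have memP D : D \in good_sets -> v \in D <->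
    [/\ semigroup_of_points D (int_vec (pt v)), aP (int_vec (pt v))
      & pt v != 0].
  move=> Dgood; split=> [vD|[Sv aPv v0]].
    have vD' : pt v \in points D by rewrite mem_points.
    have [_ ? ?] := good_setP Dgood vD'.
    by split=> //; constructor 2; exists (pt v).
  case: Sv => [|[y yD /int_vec_inj yE]|[_ _]] //; last first.
    by rewrite -mem_points yE.
  by rewrite -int_vec0 => /int_vec_inj v0'; rewrite v0' eqxx in v0.
apply/idP/idP => [/(memP A Agood)|/(memP B Bgood)].
  by rewrite AB => /(memP B Bgood).
by rewrite -AB => /(memP A Agood).
Qed.

End Dilate.
End Counting.

(** * Counting through ordered listings *)

(** Each n-element set is listed by n! duplicate-free tuples. Counting tuples
    rather than sets makes the count a sum over all matrices in a box. *)
Lemma card_ordered_listings (T : finType) (n : nat) (Q : pred {set T}) :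
  #|[set t : n.-tuple T | uniq t & Q [set x in t]]| =
  (#|[set A : {set T} | (#|A| == n) && Q A]| * n`!)%N.
Proof.
rewrite -sum1_card (partition_big (fun t : n.-tuple T => [set x in t])
  (fun A => (#|A| == n) && Q A)) /=; last first.
  move=> t; rewrite inE => /andP[ut Qt].
  by rewrite Qt cardsE (card_uniqP ut) size_tuple eqxx.
rewrite -sum_nat_const; apply: eq_big => [A|A /andP[/eqP cA QA]].
  by rewrite inE.
rewrite sum1_card; transitivity #|[set t : n.-tuple T | all [in A] t & uniq t]|.
  apply: eq_card => t; rewrite !inE unfold_in /= inE.
  apply/idP/idP => [/andP[/andP[ut _] /eqP <-]|/andP[tA ut]].
    by rewrite ut andbT; apply/allP => x xt; rewrite inE.
  have tAE : [set x in t] = A.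
    apply/eqP; rewrite eqEcard cA cardsE (card_uniqP ut) size_tuple leqnn andbT.
    by apply/fintype.subsetP => x; rewrite inE => /(allP tA).
  by rewrite ut tAE QA eqxx.
by rewrite card_uniq_tuples cA ffactnn.
Qed.

Section OrderedListings.
Variables (R : realType) (d n : nat).
Variables (inC : pred 'rV[int]_d) (inP : 'rV[int]_d -> int -> bool).

Definition rows (M : 'M[int]_(n, d)) := [seq row i M | i <- enum 'I_n].

Definition listing (M : 'M[int]_(n, d)) (a : int) :=
  uniq (rows M) && admissible inC inP a (rows M).

Lemma definable_listing :
  definable R (fun z : 'rV[int]_d * int => inC z.1) ->
  definable R (fun z : 'rV[int]_d * int => inP z.1 z.2) ->
  definable R (fun z : 'M[int]_(n, d) * int => listing z.1 z.2).
Proof.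
move=> dC dP; pose G := ('M[int]_(n, d) * int)%type.
have rowD i : {morph (fun z : G => row i z.1) : x y / x + y}.
  by move=> x y; rewrite /= linearD.
have rowP (phi : G -> 'rV[int]_d) : {morph phi : x y / x + y} ->
    {morph (fun z : G => (phi z, z.2)) : x y / x + y}.
  by move=> phiD x y; congr pair; rewrite phiD.
have addD i j : {morph (fun z : G => row i z.1 + row j z.1) : x y / x + y}.
  by move=> x y; rewrite !rowD addrACA.
have subD (u v : G -> 'rV[int]_d) : {morph u : x y / x + y} ->
    {morph v : x y / x + y} -> {morph (fun z => u z - v z) : x y / x + y}.
  by move=> uD vD x y; rewrite uD vD opprD addrACA.
have eqD (u v : G -> 'rV[int]_d) : {morph u : x y / x + y} ->
    {morph v : x y / x + y} -> definable R (fun z => u z == v z).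
  move=> uD vD; apply: eq_definable (definable_row_eq0 R (subD u v uD vD)) => z.
  by rewrite subr_eq0.
have dU i j : definable R (fun z : G => (i == j) || (row i z.1 != row j z.1)).
  apply: definable_or; first exact: pw_cst.
  exact: definableN (eqD _ _ (rowD i) (rowD j)).
have dpt i : definable R (fun z : G =>
    [&& inC (row i z.1), inP (row i z.1) z.2 & row i z.1 != 0]).
  apply: definable_and; first exact: (definable_comp (rowP _ (rowD i)) dC).
  apply: definable_and; first exact: (definable_comp (rowP _ (rowD i)) dP).
  exact: (definableN (definable_row_eq0 R (rowD i))).
have dsum i j : definable R (fun z : G => ~~ inP (row i z.1 + row j z.1) z.2 ||
    [exists k, row i z.1 + row j z.1 == row k z.1]).
  apply: definable_or.
    exact: (definableN (definable_comp (rowP _ (addD i j)) dP)).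
  by apply: definable_exists => k; apply: eqD.
apply: eq_definable (definable_and
  (definable_forall (fun i => definable_forall (dU i)))
  (definable_and (definable_forall dpt)
    (definable_forall (fun i => definable_forall (dsum i))))) => -[M a] /=.
rewrite /listing /admissible; congr (_ && _).
  apply/forallP/idP => [Minj|/injectiveP Minj i].
    apply/injectiveP => i j ij; apply/eqP.
    by have /forallP/(_ j)/orP[//|] := Minj i; rewrite ij eqxx.
  apply/forallP => j; have [//|ij /=] := eqVneq i j.
  by apply: contra ij => /eqP/Minj ->.
have all_rows (p : pred 'rV[int]_d) : [forall i, p (row i M)] = all p (rows M).
  rewrite all_map; apply/forallP/allP => H i; first by move=> _; apply: H.
  by apply: H; rewrite mem_enum.
congr (_ && _); first exact: (all_rows (fun x => [&& inC x, inP x a & x != 0])).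
rewrite -all_rows; apply: eq_forallb => i; rewrite -all_rows.
apply: eq_forallb => j; congr (_ || _).
by apply/existsP/mapP => -[k] => [/eqP ->|_ ->]; exists k; rewrite ?mem_enum.
Qed.

Lemma card_good_sets_listings (N a : nat) :
  (#|good_sets inC inP N n a| * n`!)%N =
  #|[set M : 'M['I_((N * a).*2.+1)]_(n, d) | listing (recenter M) a%:Z]|.
Proof.
rewrite -(card_ordered_listings n (fun A => admissible inC inP a (points A))).
pose T := 'rV['I_((N * a).*2.+1)]_d.
pose f (M : 'M['I_((N * a).*2.+1)]_(n, d)) : n.-tuple T :=
  [tuple row i M | i < n].
rewrite -sum1_card (reindex f) /=; last first.
  exists (fun t : n.-tuple T => \matrix_(i, j) (tnth t i) 0 j) => [M _|t _].
    by apply/matrixP => i j; rewrite !mxE tnth_mktuple mxE.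
  apply: eq_from_tnth => i; rewrite tnth_mktuple.
  by apply/rowP => j; rewrite !mxE.
rewrite -sum1_card; apply: eq_bigl => M; rewrite !inE /listing.
have rowsE : rows (recenter M) = [seq recenter v | v <- f M].
  rewrite /f /= -map_comp; apply: eq_map => i /=.
  by rewrite /recenter map_row.
rewrite rowsE (map_inj_uniq (@recenter_inj _ _ _)); congr (_ && _).
apply: eq_admissible => x; apply/mapP/mapP => -[v vM ->]; exists v => //.
  by rewrite mem_enum inE in vM.
by rewrite mem_enum inE.
Qed.

Lemma listing_count (N : nat) :
  definable R (fun z : 'rV[int]_d * int => inC z.1) ->
  definable R (fun z : 'rV[int]_d * int => inP z.1 z.2) ->
  exists2 h : int -> R, quasipoly h & forall a : nat, (0 < a)%N ->
    (#|good_sets inC inP N n a| * n`!)%:R = h a%:Z.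
Proof.
move=> dC dP.
have [f pf fE] := pw_sum_matrix N (definable_listing dC dP).
have [h qh hE] := pw_quasipoly_pos pf.
exists h => // a a_gt0; rewrite -hE // -fE card_good_sets_listings.
rewrite -sum1_card natr_sum big_mkcond /=; apply: eq_bigr => M _.
by rewrite inE; case: ifP.
Qed.

End OrderedListings.

(** * Growth and degree *)

Lemma count_le (d n : nat) (inC : pred 'rV[int]_d)
    (inP : 'rV[int]_d -> int -> bool) (N a : nat) : (0 < a)%N ->
  (#|good_sets inC inP N n a| * n`! <= (N.*2.+1 * a) ^ (n * d))%N.
Proof.
move=> a_gt0; rewrite card_good_sets_listings.
apply: leq_trans (max_card _) _; rewrite card_mx card_ord.
by case: (n * d)%N => [|e]; rewrite ?expn0 // leq_exp2r //; nia.
Qed.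

Section Growth.
Variables (R : realType) (d n : nat) (C P : set 'rV[R]_d).
Variables (inC : pred 'rV[int]_d) (inP : 'rV[int]_d -> int -> bool) (N : nat).
Hypotheses (d_gt0 : (0 < d)%N)
  (C_int : forall x, C (int_vec R x) <-> inC x)
  (P_int : forall x (a : nat), (0 < a)%N ->
     dilate a%:R P (int_vec R x) <-> inP x a%:Z)
  (P_bounded : forall x j, P x -> `|x 0 j| <= N%:R)
  (P0 : P 0).

(** The i-th row ranges over its own block k z + i k + [0, k[^d of the cube,
    which makes the rows distinct. All sums leave the dilate, so the listing is
    admissible; 0 is not in the cube, because 0 + 0 does not leave the
    dilate. *)
Lemma count_ge (L k : nat) (z : 'rV[int]_d) :
  let cube (x : 'rV[int]_d) := forall j,
      k%:Z * z 0 j <= x 0 j <= k%:Z * z 0 j + (n * k)%N%:Z in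
  (0 < L)%N -> (0 < k)%N ->
  (forall x, cube x -> C (int_vec R x) /\ dilate (L * k)%:R P (int_vec R x)) ->
  (forall x y, cube x -> cube y -> ~ dilate (L * k)%:R P (int_vec R (x + y))) ->
  (k ^ (n * d) <= #|good_sets inC inP N n (L * k)| * n`!)%N.
Proof.
move=> cube L_gt0 k_gt0 cubeP cube_sum.
have a_gt0 : (0 < L * k)%N by rewrite muln_gt0 L_gt0.
pose Z (A : 'M['I_k]_(n, d)) : 'M[int]_(n, d) :=
  \matrix_(i, j) (k%:Z * z 0 j + (i * k + A i j)%N%:Z).
have Zcube A i : cube (row i (Z A)).
  move=> j; rewrite !mxE; have := ltn_ord (A i j); have := ltn_ord i.
  move: (k%:Z * z 0 j) => t ? ?; nia.
have Zlisting A : listing inC inP (Z A) (L * k)%N%:Z.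
  apply/andP; split.
    apply/injectiveP => i j /rowP/(_ (Ordinal d_gt0)); rewrite !mxE => ij.
    apply/val_inj => /=; have := ltn_ord (A i (Ordinal d_gt0)).
    have := ltn_ord (A j (Ordinal d_gt0)); nia.
  apply/andP; split; apply/allP => _ /mapP[i _ ->].
    have [Cx Px] := cubeP _ (Zcube A i).
    apply/and3P; split; [exact/C_int | exact/P_int |].
    apply/eqP => x0; have := cube_sum _ _ (Zcube A i) (Zcube A i); apply.
    by rewrite x0 addr0 int_vec0; exists 0; rewrite ?scaler0.
  apply/allP => _ /mapP[j _ ->]; apply/orP; left.
  apply/negP => /(P_int _ a_gt0); exact: cube_sum.
have /choice[g gE] : forall A : 'M['I_k]_(n, d),
    exists B : 'M['I_((N * (L * k)).*2.+1)]_(n, d), recenter B = Z A.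
  move=> A; apply: recenter_surj => i j.
  have [_ Px] := cubeP _ (Zcube A i).
  by have := dilate_bounded P_bounded a_gt0 j Px; rewrite mxE.
have g_inj : injective g.
  move=> A B AB; have : Z A = Z B by rewrite -!gE AB.
  move=> /matrixP ZAB; apply/matrixP => i j; apply/val_inj => /=.
  by have := ZAB i j; rewrite !mxE; lia.
rewrite card_good_sets_listings -[in leqLHS](card_ord k) -card_mx.
rewrite -cardsT -(card_imset _ g_inj); apply/subset_leq_card/fintype.subsetP.
by move=> _ /imsetP[A _ ->]; rewrite inE gE.
Qed.

End Growth.

Section Degree.
Variable R : realType.
Implicit Types (h : int -> R) (p : {poly R}).

(** The factor x on the left encodes the bound x^(s-1) without subtraction, and
    forces p = 0 when s = 0. *)
Lemma horner_mul_le p (s : nat) : (size p <= s)%N ->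
  exists2 B : R, 0 <= B & forall x : R, 1 <= x -> `|p.[x]| * x <= B * x ^+ s.
Proof.
move=> ps; exists (\sum_(i < s) `|p`_i|); first exact: sumr_ge0.
move=> x x_ge1; have x_ge0 : 0 <= x by apply: le_trans x_ge1.
rewrite (horner_coef_wide _ ps) mulr_suml.
apply: le_trans (ler_wpM2r x_ge0 (ler_norm_sum _ _ _)) _.
rewrite mulr_suml; apply: ler_sum => i _.
rewrite normrM (ger0_norm (exprn_ge0 _ x_ge0)) -mulrA -exprSr.
by rewrite ler_wpM2l // ler_weXn2l.
Qed.

Lemma size_le_growth p (e : nat) (B : R) :
  (forall M : R, exists2 x, M <= x & `|p.[x]| <= B * x ^+ e) ->
  (size p <= e.+1)%N.
Proof.
move=> pB; rewrite leqNgt; apply/negP => pe.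
set s := (size p).-1; have ps : size p = s.+1.
  by rewrite /s prednK //; apply: leq_trans pe.
have es : (e.+1 <= s)%N by rewrite ps in pe.
pose q := p - lead_coef p *: 'X^s.
have qs : (size q <= s)%N.
  apply/leq_sizeP => j; rewrite leq_eqVlt => /predU1P[<-|sj].
    by rewrite coefB coefZ coefXn eqxx mulr1 lead_coefE ps subrr.
  by rewrite coefB coefZ coefXn gtn_eqF // mulr0 subr0 nth_default ?ps.
have [B' B'_ge0 qB'] := horner_mul_le qs.
have l_gt0 : 0 < `|lead_coef p|.
  by rewrite normr_gt0 lead_coef_eq0 -size_poly_eq0 ps.
have [x xM px] := pB (Num.max 1 ((`|B| + B') / `|lead_coef p| + 1)).
move: xM; rewrite ge_max => /andP[x_ge1 xM].
have x_gt0 : 0 < x by apply: lt_le_trans x_ge1.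
have: `|lead_coef p| * x ^+ s * x <= (`|B| + B') * x ^+ s.
  have -> : `|lead_coef p| * x ^+ s = `|p.[x] - q.[x]|.
    rewrite /q hornerD hornerN opprB addrCA subrr addr0 hornerZ hornerXn normrM.
    by rewrite [`|x ^+ s|]ger0_norm // exprn_ge0 // ltW.
  apply: le_trans (ler_wpM2r (ltW x_gt0) (ler_normB _ _)) _.
  rewrite mulrDl mulrDl lerD ?qB' //.
  apply: le_trans (ler_wpM2r (ltW x_gt0) px) _.
  rewrite -mulrA -exprSr; apply: le_trans (ler_wpM2r _ (ler_norm B)) _.
    by rewrite exprn_ge0 // ltW.
  by rewrite ler_wpM2l // ler_weXn2l.
rewrite mulrAC ler_pM2r ?exprn_gt0 // mulrC -ler_pdivlMr //.
by move=> /(le_trans xM); rewrite gerDl ler10.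
Qed.

(** The upper bound on h holds on every residue class, so each constituent has
    degree at most e. If all had degree less than e, then h (a) would be
    O(a^(e-1)), against the lower bound on the multiples of L. *)
Lemma quasipoly_degree h (e L : nat) (B c : R) : quasipoly h ->
  (forall a : nat, (0 < a)%N -> `|h a%:Z| <= B * a%:R ^+ e) ->
  (0 < L)%N -> 0 < c ->
  (forall k : nat, (0 < k)%N -> c * k%:R ^+ e <= h (L * k)%N%:Z) ->
  quasi_polynomial_of_degree e h.
Proof.
move=> [K K_gt0 hK] hB L_gt0 c_gt0 hc.
have K_neq0 : K%:R != 0 :> R by rewrite pnatr_eq0 -lt0n.
have /choice[p pE] : forall r : 'I_K, exists p : {poly R},
    forall x : int, h (r%:Z + K%:Z * x) = p.[(r%:Z + K%:Z * x)%:~R].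
  move=> r; have [p pE] := hK r%:Z.
  exists (p \Po (K%:R^-1 *: ('X - r%:R%:P))) => x.
  rewrite pE horner_comp !hornerE rmorphD rmorphM /= -!pmulrn addrC addKr.
  by rewrite mulKf.
have sz r : (size (p r) <= e.+1)%N.
  apply: (size_le_growth (B := B)) => M.
  pose x := (Num.bound M).+1.
  have a_gt0 : (0 < r + K * x)%N by rewrite addn_gt0 muln_gt0 K_gt0 orbT.
  have aE : (r + K * x)%N%:Z = r%:Z + K%:Z * x%:Z by rewrite PoszD PoszM.
  exists (r + K * x)%N%:R; last first.
    by have := hB _ a_gt0; rewrite aE pE -aE -pmulrn.
  have [M_ge0|M_lt0] := leP 0 M; last first.
    exact: le_trans (ltW M_lt0) (ler0n _ _).
  apply: ltW; apply: lt_le_trans (archi_boundP M_ge0) _; rewrite ler_nat.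
  apply: leq_trans (leqnSn _) _; apply: leq_trans (leq_addl _ _).
  by rewrite leq_pmull.
exists K, p; split=> //.
  move=> r a; have [s [y ->]] := int_residue a K_gt0.
  rewrite modzMDl => /eqP rs; have -> : r = s.
    apply/val_inj/eqP; rewrite /= eq_sym -eqz_nat; move: rs.
    by rewrite !modz_small ?ltz_nat ?ltn_ord.
  by rewrite addrC mulrC pE.
apply/eqP; rewrite eqn_leq; apply/andP; split; first exact/bigmax_leqP.
rewrite ltnNge; apply/negP => /bigmax_leqP sz_le.
have /choice[b bP] : forall r, exists b : R, 0 <= b /\
    forall x : R, 1 <= x -> `|(p r).[x]| * x <= b * x ^+ e.
  by move=> r; have [b b_ge0 bP] := horner_mul_le (sz_le r isT); exists b.
pose b' := \sum_r b r; have b'_ge0 : 0 <= b'.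
  by apply: sumr_ge0 => r _; case: (bP r).
have hb a : (0 < a)%N -> `|h a%:Z| * a%:R <= b' * a%:R ^+ e.
  move=> a_gt0; have [r [y aE]] := int_residue a%:Z K_gt0.
  have -> : h a%:Z = (p r).[a%:R].
    by rewrite aE addrC mulrC pE pmulrn aE addrC mulrC.
  have [_ H] := bP r; apply: le_trans (H _ _) _; first by rewrite ler1n.
  rewrite ler_wpM2r ?exprn_ge0 // /b' (bigD1 r) //= lerDl sumr_ge0 // => s _.
  by case: (bP s).
pose k := (Num.bound (b' * L%:R ^+ e / (c * L%:R))).+1.
have L_gt0' : 0 < L%:R :> R by rewrite ltr0n.
have k_gt0 : 0 < k%:R :> R by rewrite ltr0n.
have cL_gt0 : 0 < c * L%:R by rewrite mulr_gt0.
have : c * k%:R ^+ e * (L * k)%:R <= b' * (L * k)%:R ^+ e.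
  apply: le_trans (hb _ _); last by rewrite muln_gt0 L_gt0.
  by rewrite ler_wpM2r ?ler0n // (le_trans (hc k _)) // ler_norm.
rewrite natrM exprMn [leRHS]mulrA.
have -> : c * k%:R ^+ e * (L%:R * k%:R) = (c * L%:R * k%:R) * k%:R ^+ e by ring.
rewrite ler_pM2r ?exprn_gt0 // -ler_pdivlMl // [leRHS]mulrC leNgt => /negP.
apply.
apply: lt_le_trans (archi_boundP _) _.
  by rewrite divr_ge0 ?(ltW cL_gt0) // mulr_ge0 // exprn_ge0.
by rewrite ler_nat.
Qed.

End Degree.

(** * The main theorem *)

Local Open Scope card_scope.
Local Open Scope classical_set_scope.

Theorem corollary4 (R : realType) (d : nat) (d_gt0 : (0 < d)%N)
    (C P : set 'rV[R]_d)
    (C_rational : rational_cone C)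
    (C_pointed : pointed_cone C)
    (C_full : full_dimensional C)
    (P_compatible : compatible C P)
    (n : nat) :
  exists f : nat -> nat,
    (forall a : nat, (0 < a)%N ->
       [set S : set 'rV[R]_d |
          [/\ C_semigroup C S,
              (S `&` dilate a%:R P) #= `I_n.+1
            & gaps C S `<=` dilate a%:R P]] #= `I_(f a)) /\
    quasi_polynomial_on_positives_of_degree R (n * d) f.
Proof.
have Ccone := rational_cone_convex C_rational; have [C0 _ _] := Ccone.
have [P_rational P_nbhs _] := P_compatible.
have [N P_bounded] := polytope_bounded P_rational.
have P0 : P 0.
  have [e e_gt0 eP] := within_coordinates P_nbhs; apply: eP => // j.
  by rewrite mxE normr0 ltW.
have [U C_dual] : exists U, forall x, C x <-> in_dual U x.
  by case: C_rational => m [v ->]; apply: weyl.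
have [V P_dual] := dilate_in_dual P_rational.
pose inC (x : 'rV[int]_d) := in_dual U (int_vec R x).
pose inP (x : 'rV[int]_d) (a : int) :=
  in_dual V (homogenize (int_vec R x) a%:~R).
have C_int x : C (int_vec R x) <-> inC x by apply: C_dual.
have P_int x (a : nat) : (0 < a)%N ->
    dilate a%:R P (int_vec R x) <-> inP x a%:Z.
  by move=> a_gt0; apply: P_dual.
have dC : definable R (fun z : 'rV[int]_d * int => inC z.1).
  exact: definable_in_dual.
have dP : definable R (fun z : 'rV[int]_d * int => inP z.1 z.2).
  pose phi (z : 'rV[int]_d * int) : 'rV[int]_(d + 1) :=
    row_mx z.1 (const_mx z.2).
  have phiD : {morph phi : x y / x + y}.
    move=> x y; rewrite /phi add_row_mx; congr row_mx.
    by apply/rowP => j; rewrite !mxE.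
  apply: eq_definable (definable_in_dual R V phiD) => -[x a].
  by rewrite /phi map_row_mx map_const_mx.
have [h qh hE] := listing_count n N dC dP.
have fact_gt0R : 0 < (n`!)%:R :> R by rewrite ltr0n fact_gt0.
have fE (a : nat) : (0 < a)%N ->
    (#|good_sets inC inP N n a|)%:R = h a%:Z * (n`!)%:R^-1.
  by move=> a_gt0; rewrite -hE // natrM mulfK // gt_eqF.
exists (fun a => #|good_sets inC inP N n a|); split.
  move=> a a_gt0.
  exact: (card_dilate_semigroups Ccone C_pointed C_int P_int P_bounded P0
    (compatible_outside P_compatible)).
exists (fun a => h a * (n`!)%:R^-1); split; last exact: fE.
have [L [z [L_gt0 cubeP]]] :=
  sum_free_cube d_gt0 C_rational C_pointed C_full P_compatible n.
apply: (@quasipoly_degree _ _ _ L (N.*2.+1 ^ (n * d))%:R (n`!)%:R^-1) => //.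
- exact: quasipolyM (quasipolyC _).
- move=> a a_gt0; rewrite -fE // normr_nat -natrX -natrM ler_nat -expnMn.
  apply: leq_trans (count_le n inC inP N a_gt0).
  by rewrite leq_pmulr // fact_gt0.
- move=> k k_gt0; have Lk_gt0 : (0 < L * k)%N by rewrite muln_gt0 L_gt0.
  have [cube_in cube_sum] := cubeP k k_gt0.
  rewrite mulrC ler_wpM2r ?invr_ge0 ?ler0n // -hE // -natrX ler_nat.
  exact: (count_ge d_gt0 C_int P_int P_bounded P0 L_gt0 k_gt0 cube_in cube_sum).
Qed.
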